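(* Let $\mathrm T$ be the 1-dimensional torus with weights $\alpha_k=k\alpha_1$, $1\le k\le n$, and for $n\ge5$ let $\mathcal A_n=\{(2,3)\}\cup\{(1,k):1<k<n\}$. The scheme $\mathfrak L_n^{\mathrm T,\mathcal A_n}$ is given by: 1. For $n=5,6$: a single rigid Lie algebra; the scheme is reduced and the local ring is trivial ($\simeq\mathbb K$). 2. For $7\le n\le11$: a continuous family of Lie algebras $\mathfrak f_n(t)$, where $t$ runs through $\mathbb K$ except for a finite number of points ($t\in\mathbb K$ for $n=7,8$; $t\ne-2$ for $n=9,10$; $t\ne-2,\pm1$ for $n=11$), defined by those of the following structure constants $X_{ij}$ with $i+j\le n$: $X_{1i}=1$ $(1<i<n)$, $X_{23}=X_{24}=1$, $X_{25}=1-t$, $X_{34}=t$, $X_{26}=1-2t$, $X_{35}=t$, $X_{27}=\frac{2-5t}{2+t}$, $X_{36}=\frac{2t-2t^2}{2+t}$, $X_{45}=\frac{3t^2}{2+t}$, $X_{28}=\frac{2-7t+5t^2}{2+t}$, $X_{37}=\frac{2t-5t^2}{2+t}$, $X_{46}=\frac{3t^2}{2+t}$, $X_{29}=\frac{2-10t+16t^2-5t^3}{2(1-t^2)}$, $X_{38}=\frac{4t-16t^2+8t^3-5t^4}{2(2+t)(1-t^2)}$, $X_{47}=\frac{6t^2-12t^3+15t^4}{2(2+t)(1-t^2)}$, $X_{56}=\frac{12t^3-21t^4}{2(2+t)(1-t^2)}$. 3. For $n\ge12$: two rigid Lie algebras, $\mathfrak f_n$ (for $t=0$) and $\mathfrak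 w_n$ (for $t=1/10$), where $t=X_{34}$. The scheme is reduced at the point $\mathfrak w_n$ and its local ring there is trivial ($\simeq\mathbb K$). The scheme is not reduced at the point $\mathfrak f_n$ and possesses there a nilpotent element $t$ of order $5$ ($t^5=0$, $t^4\neq0$); the local ring may be written $\bigoplus_{k=0}^4\mathbb K t^k\simeq\mathbb K[u]/(u^5)$. The canonical deformation of $\mathfrak f_n$ in this scheme is defined by the following structure constants: $X_{1i}=1$ $(1<i<n)$; $X_{23}=X_{24}=1$, $X_{25}=1-t$, $X_{26}=1-2t$; $X_{2,m-2}=1+(6-m)t+\frac{3m^2-45m+168}{4}t^2+\frac{-4m^3+105m^2-923m+2712}{8}t^3+\frac{5m^4-192m^3+2812m^2-18579m+46608}{16}t^4$ for $n\ge m\ge9$; $X_{34}=X_{35}=t$, $X_{36}=t-\frac32t^2+\frac34t^3-\frac38t^4$, $X_{37}=t-3t^2+\frac32t^3-\frac34t^4$; $X_{3,m-3}=t+\frac32(8-m)t^2+\frac{6m^2-111m+516}{4}t^3+\frac{-10m^3+303m^2-3110m+10794}{8}t^4$ for $n\ge m\ge11$; $X_{45}=X_{46}=\frac32t^2-\frac34t^3+\frac38t^4$; $X_{4,m-4}=\frac32t^2+\frac{-12m+117}{4}t^3+\frac{30m^2-636m+3423}{8}t^4$ for $n\ge m\ge11$; $X_{56}=X_{57}=3t^3-\frac{27}{4}t^4$; $X_{5,m-5}=3t^3+\frac{-30m+333}{4}t^4$ for $n\ge m\ge12$; $X_{6,m-6}=\frac{15}{2}t^4$ for $n\ge m\ge13$;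 and $X_{ij}=0$ for $6<i<j$.
   Context: $\mathbb K$ is an algebraically closed field of characteristic $0$. The torus $\mathrm T$ acts on $\mathbb K^n$ by $t\cdot e_i=\alpha_i(t)e_i$. $\mathfrak L_n^{\mathrm T}$ is the affine scheme of Lie algebra laws on $\mathbb K^n$ admitting $\mathrm T$ as derivations: coordinates $X_{ij}$, $i<j$, $i+j\le n$, law $[e_i,e_j]=X_{ij}e_{i+j}$ (zero if $i+j>n$), with Jacobi relations $X_{i,j}X_{i+j,k}+X_{j,k}X_{j+k,i}+X_{k,i}X_{k+i,j}=0$ for $i<j<k$, $i+j+k\le n$ (with $X_{ji}=-X_{ij}$). $\mathfrak L_n^{\mathrm T,\mathcal A_n}$ is the closed subscheme defined by $X_{ij}=1$ for all $(i,j)\in\mathcal A_n$. The canonical deformation of a point of this scheme is the law over the local ring at this point whose structure constants are the germs of the coordinate functions. $\mathfrak f_n$ is the law with $X_{1i}=1$ ($1<i<n$), $X_{2i}=1$ ($2<i\le n-2$), other $X_{ij}=0$. $\mathfrak w_n$ is the Witt Lie algebra: the law of the slice isomorphic to the algebra with basis $f_1,\dots,f_n$ and $[f_i,f_j]=(j-i)f_{i+j}$ if $i+j\le n$, $0$ otherwise (normalized so that $X_{1k}=1$, $X_{23}=1$). Rigid means formally rigid in $\mathfrak L_n^{\mathrm T}$: every $\mathbb K[[s]]$-point of $\mathfrak L_n^{\mathrm T}$ reducing to the law at $s=0$ is conjugate to the constant one by an element $\equiv\mathrm{id}$ mod $s$ commuting with $\mathrm T$. *)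

(* Defs.v *)
From HB Require Import structures.
From mathcomp Require Import all_boot all_order all_algebra.
From mathcomp Require Import boolp generic_quotient mpoly.
From mathcomp Require Import ring.

Set Implicit Arguments.
Unset Strict Implicit.
Unset Printing Implicit Defensive.

Import GRing.Theory.
Local Open Scope ring_scope.
Local Open Scope quotient_scope.

Section GeneratedIdeal.
Variables (R : comNzRingType) (gens : seq R).

Definition ideal_gen (a : R) : Prop :=
  exists c : {ffun 'I_(size gens) -> R}, a = \sum_i c i * gens`_i.

Lemma ideal_gen0 : ideal_gen 0.
Proof. by exists 0; rewrite big1 // => i _; rewrite ffunE mul0r. Qed.

Lemma ideal_genD a b : ideal_gen a -> ideal_gen b -> ideal_gen (a + b).
Proof.
move=> [c ->] [d ->]; exists (c + d); rewrite -big_split /=.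
by apply: eq_bigr => i _; rewrite ffunE mulrDl.
Qed.

Lemma ideal_genM r a : ideal_gen a -> ideal_gen (r * a).
Proof.
move=> [c ->]; exists [ffun i => r * c i]; rewrite mulr_sumr.
by apply: eq_bigr => i _; rewrite ffunE mulrA.
Qed.

End GeneratedIdeal.

(* S^-1 (R / (gens)) as a quotient of the set of fractions a / d, d \in S.    *)
(* It is the zero ring when S meets (gens), hence the "Pz" structure.         *)
Section Localization.
Variables (K : comNzRingType) (R : comAlgType K).
Variables (S : mulrClosed R) (gens : seq R).

Notation I := (ideal_gen gens).
Notation den := {d : R | d \in S}.

Definition frac_equiv (x y : R * den) : bool :=
  `[< exists2 u, u \in S & I (u * (x.1 * val y.2 - y.1 * val x.2)) >].

Lemma frac_equiv_class : equiv_class_of frac_equiv.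
Proof.
split=> [x|x y|y x z].
- by apply/asboolP; exists 1; rewrite ?rpred1 // subrr mulr0; exact: ideal_gen0.
- apply/asboolP/asboolP => -[u uS uI]; exists u => //.
  + by rewrite -opprB mulrN -mulN1r; exact: ideal_genM.
  + by rewrite -opprB mulrN -mulN1r; exact: ideal_genM.
- move=> /asboolP[u uS uI] /asboolP[v vS vI]; apply/asboolP.
  exists (u * v * val y.2); first by rewrite !rpredM //; exact: valP.
  have -> : u * v * val y.2 * (x.1 * val z.2 - z.1 * val x.2) =
    (v * val z.2) * (u * (x.1 * val y.2 - y.1 * val x.2)) +
    (u * val x.2) * (v * (y.1 * val z.2 - z.1 * val y.2)) by ring.
  by apply: ideal_genD; exact: ideal_genM.
Qed.

Canonical frac_equiv_rel := EquivRelPack frac_equiv_class.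
Canonical frac_encModRel := defaultEncModRel frac_equiv.

Definition localization := {eq_quot frac_equiv}.
HB.instance Definition _ := Choice.on localization.

Definition den1 : den := exist _ 1 (rpred1 S).
Definition denM (d e : den) : den := exist _ (val d * val e)%R (rpredM (valP d) (valP e)).

Definition frac (a : R) (d : den) : localization := \pi_localization (a, d).

Lemma frac_eqP a d b e : reflect
  (exists2 u, u \in S & I (u * (a * val e - b * val d))) (frac a d == frac b e).
Proof. by rewrite /frac piE; exact: asboolP. Qed.

Lemma frac_eq a d b e : a * val e = b * val d -> frac a d = frac b e.
Proof.
move=> e_; apply/eqP/frac_eqP; exists 1; first exact: rpred1.
by rewrite e_ subrr mulr0; exact: ideal_gen0.
Qed.

Lemma fracP (x : localization) : {p : R * den | x = frac p.1 p.2}.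
Proof. by exists (repr x); rewrite /frac -surjective_pairing reprK. Qed.

Definition loc_add (x y : localization) : localization :=
  frac ((repr x).1 * val (repr y).2 + (repr y).1 * val (repr x).2)
       (denM (repr x).2 (repr y).2).
Definition loc_opp (x : localization) := frac (- (repr x).1) (repr x).2.
Definition loc_mul (x y : localization) : localization :=
  frac ((repr x).1 * (repr y).1) (denM (repr x).2 (repr y).2).
Definition loc_scale (c : K) (x : localization) :=
  frac (c *: (repr x).1) (repr x).2.

Lemma repr_frac a d : exists2 u, u \in S &
  I (u * ((repr (frac a d)).1 * val d - a * val (repr (frac a d)).2)).
Proof.
by apply/frac_eqP; rewrite /frac -surjective_pairing reprK.
Qed.

Lemma addE a d b e :
  loc_add (frac a d) (frac b e) = frac (a * val e + b * val d) (denM d e).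
Proof.
rewrite /loc_add; case: (repr_frac a d) (repr_frac b e).
case: (repr (frac a d)) (repr (frac b e)) => [a' d'] [b' e'] /= u uS uI [v vS vI].
apply/eqP/frac_eqP; exists (u * v); first exact: rpredM.
rewrite /=.
have -> : u * v * ((a' * val e' + b' * val d') * (val d * val e) -
   (a * val e + b * val d) * (val d' * val e')) =
  (v * val e * val e') * (u * (a' * val d - a * val d')) +
  (u * val d * val d') * (v * (b' * val e - b * val e')) by ring.
by apply: ideal_genD; exact: ideal_genM.
Qed.

Lemma mulE a d b e : loc_mul (frac a d) (frac b e) = frac (a * b) (denM d e).
Proof.
rewrite /loc_mul; case: (repr_frac a d) (repr_frac b e).
case: (repr (frac a d)) (repr (frac b e)) => [a' d'] [b' e'] /= u uS uI [v vS vI].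
apply/eqP/frac_eqP; exists (u * v); first exact: rpredM.
rewrite /=.
have -> : u * v * (a' * b' * (val d * val e) - a * b * (val d' * val e')) =
  (v * b' * val e) * (u * (a' * val d - a * val d')) +
  (u * a * val d') * (v * (b' * val e - b * val e')) by ring.
by apply: ideal_genD; exact: ideal_genM.
Qed.

Lemma oppE a d : loc_opp (frac a d) = frac (- a) d.
Proof.
rewrite /loc_opp; case: (repr_frac a d).
case: (repr (frac a d)) => [a' d'] /= u uS uI.
apply/eqP/frac_eqP; exists u => //.
have -> : u * (- a' * val d - - a * val d') =
  -1 * (u * (a' * val d - a * val d')) by ring.
exact: ideal_genM.
Qed.

Lemma scaleE c a d : loc_scale c (frac a d) = frac (c *: a) d.
Proof.
rewrite /loc_scale; case: (repr_frac a d).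
case: (repr (frac a d)) => [a' d'] /= u uS uI.
apply/eqP/frac_eqP; exists u => //.
rewrite -!scalerAl -scalerBr -scalerAr -mulr_algl.
exact: ideal_genM.
Qed.

Fact loc_addA : associative loc_add.
Proof.
move=> x y z; case: (fracP x) (fracP y) (fracP z) => -[a d] -> [[b e] ->] [[c f] ->].
by rewrite !addE /=; apply: frac_eq; rewrite /=; ring.
Qed.

Fact loc_addC : commutative loc_add.
Proof.
move=> x y; case: (fracP x) (fracP y) => -[a d] -> [[b e] ->].
by rewrite !addE /=; apply: frac_eq; rewrite /=; ring.
Qed.

Fact loc_add0 : left_id (frac 0 den1) loc_add.
Proof.
move=> x; case: (fracP x) => -[a d] ->.
by rewrite !addE /=; apply: frac_eq; rewrite /=; ring.
Qed.

Fact loc_addN : left_inverse (frac 0 den1) loc_opp loc_add.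
Proof.
move=> x; case: (fracP x) => -[a d] ->.
by rewrite oppE addE /=; apply: frac_eq; rewrite /=; ring.
Qed.

HB.instance Definition _ :=
  GRing.isZmodule.Build localization loc_addA loc_addC loc_add0 loc_addN.

Fact loc_mulA : associative loc_mul.
Proof.
move=> x y z; case: (fracP x) (fracP y) (fracP z) => -[a d] -> [[b e] ->] [[c f] ->].
by rewrite !mulE /=; apply: frac_eq; rewrite /=; ring.
Qed.

Fact loc_mulC : commutative loc_mul.
Proof.
move=> x y; case: (fracP x) (fracP y) => -[a d] -> [[b e] ->].
by rewrite !mulE /=; apply: frac_eq; rewrite /=; ring.
Qed.

Fact loc_mul1 : left_id (frac 1 den1) loc_mul.
Proof.
move=> x; case: (fracP x) => -[a d] ->.
by rewrite !mulE /=; apply: frac_eq; rewrite /=; ring.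
Qed.

Fact loc_mulDl : left_distributive loc_mul loc_add.
Proof.
move=> x y z; case: (fracP x) (fracP y) (fracP z) => -[a d] -> [[b e] ->] [[c f] ->].
by rewrite !(mulE, addE) /=; apply: frac_eq; rewrite /=; ring.
Qed.

HB.instance Definition _ := GRing.Zmodule_isComPzRing.Build localization
  loc_mulA loc_mulC loc_mul1 loc_mulDl.

Fact loc_scaleA a b x : loc_scale a (loc_scale b x) = loc_scale (a * b) x.
Proof. by case: (fracP x) => -[c d] ->; rewrite !scaleE scalerA. Qed.

Fact loc_scale1 : left_id 1 loc_scale.
Proof. by move=> x; case: (fracP x) => -[c d] ->; rewrite !scaleE scale1r. Qed.

Fact loc_scaleDr : right_distributive loc_scale +%R.
Proof.
move=> k x y; case: (fracP x) (fracP y) => -[a d] -> [[b e] ->].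
rewrite /GRing.add /= !(addE, scaleE) /=; apply: frac_eq => /=.
by rewrite scalerDr !scalerAl.
Qed.

Fact loc_scaleDl x : {morph loc_scale^~ x : a b / a + b >-> a + b}.
Proof.
move=> a b; case: (fracP x) => -[c d] ->.
rewrite /GRing.add /= !(addE, scaleE) /=; apply: frac_eq => /=.
by rewrite scalerDl -mulrDl -mulrA.
Qed.

HB.instance Definition _ := GRing.Zmodule_isLmodule.Build K localization
  loc_scaleA loc_scale1 loc_scaleDr loc_scaleDl.

Definition to_loc (a : R) : localization := frac a den1.

End Localization.

Definition reduced (A : comPzRingType) : Prop :=
  forall (a : A) (k : nat), a ^+ k = 0 -> a = 0.

(* K[[s]]: coefficient sequences with the Cauchy product. *)
Definition fps (K : Type) := nat -> K.

HB.instance Definition _ (K : comNzRingType) := gen_eqMixin (fps K).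
HB.instance Definition _ (K : comNzRingType) := gen_choiceMixin (fps K).

Section PowerSeries.
Variable K : comNzRingType.
Implicit Types f g h : fps K.

Definition fpsC (a : K) : fps K := fun k => if k == 0%N then a else 0.
Definition fps_add f g : fps K := fun k => f k + g k.
Definition fps_opp f : fps K := fun k => - f k.
Definition fps_mul f g : fps K := fun k => \sum_(i < k.+1) f i * g (k - i)%N.

Fact fps_addA : associative fps_add.
Proof. by move=> f g h; apply/funext => k; rewrite /fps_add addrA. Qed.
Fact fps_addC : commutative fps_add.
Proof. by move=> f g; apply/funext => k; rewrite /fps_add addrC. Qed.
Fact fps_add0 : left_id (fpsC 0) fps_add.
Proof. by move=> f; apply/funext => k; rewrite /fps_add /fpsC if_same add0r. Qed.
Fact fps_addN : left_inverse (fpsC 0) fps_opp fps_add.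
Proof.
by move=> f; apply/funext => k; rewrite /fps_add /fps_opp /fpsC if_same addNr.
Qed.

HB.instance Definition _ :=
  GRing.isZmodule.Build (fps K) fps_addA fps_addC fps_add0 fps_addN.

Definition fps_trunc N f : {poly K} := \poly_(i < N) f i.

Lemma fps_mulE N f g k : (k < N)%N ->
  fps_mul f g k = (fps_trunc N f * fps_trunc N g)`_k.
Proof.
move=> kN; rewrite /fps_mul coefM; apply: eq_bigr => i _; rewrite !coef_poly.
by rewrite (leq_ltn_trans (leq_subr _ _) kN) (leq_ltn_trans _ kN) // -ltnS.
Qed.

Fact fps_mulC : commutative fps_mul.
Proof.
by move=> f g; apply/funext => k; rewrite !(@fps_mulE k.+1) // mulrC.
Qed.

Fact fps_mulA : associative fps_mul.
Proof.
move=> f g h; apply/funext => k.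
have E u v w : fps_mul u (fps_mul v w) k =
    (fps_trunc k.+1 u * (fps_trunc k.+1 v * fps_trunc k.+1 w))`_k.
  rewrite coefM {1}/fps_mul; apply: eq_bigr => i _; rewrite coef_poly ltn_ord.
  by rewrite (@fps_mulE k.+1) // ltnS leq_subr.
by rewrite E (fps_mulC _ h) E mulrA mulrC.
Qed.

Fact fps_mul1 : left_id (fpsC 1) fps_mul.
Proof.
move=> f; apply/funext => k; rewrite /fps_mul big_ord_recl /= subn0 mul1r.
by rewrite big1 ?addr0 // => i _; rewrite mul0r.
Qed.

Fact fps_mulDl : left_distributive fps_mul fps_add.
Proof.
move=> f g h; apply/funext => k; rewrite /fps_mul /fps_add -big_split /=.
by apply: eq_bigr => i _; rewrite mulrDl.
Qed.

Fact fps_1_neq0 : fpsC 1 != 0 :> fps K.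
Proof.
by apply/eqP => /(congr1 (@^~ 0%N)); rewrite /fpsC /=; apply/eqP/oner_neq0.
Qed.

HB.instance Definition _ := GRing.Zmodule_isComNzRing.Build (fps K)
  fps_mulA fps_mulC fps_mul1 fps_mulDl fps_1_neq0.

End PowerSeries.

(* Coordinates of the laws: pairs (i, j) with 0 < i < j and i + j <= n.       *)
Definition pair_index_seq (n : nat) : seq (nat * nat) :=
  [seq p <- [seq (i, j) | i <- iota 1 n, j <- iota 1 n]
     | (p.1 < p.2) && (p.1 + p.2 <= n)]%N.

Definition pair_index (n : nat) := seq_sub (pair_index_seq n).

Definition constants (n : nat) (R : Type) := {ffun pair_index n -> R}.

Definition of_table (n : nat) (R : Type) (c : nat -> nat -> R) : constants n R :=
  [ffun p => c (val p).1 (val p).2].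

Section Laws.
Variables (n : nat) (R : comPzRingType).
Implicit Types x y : constants n R.

(* X_ij extended to all i, j by X_ji = - X_ij, and by 0 outside the range.    *)
Definition coef x (i j : nat) : R :=
  if insub (i, j) is Some p then x p
  else if insub (j, i) is Some p then - x p else 0.

Definition jacobi x (i j k : nat) : R :=
  coef x i j * coef x (i + j) k + coef x j k * coef x (j + k) i
  + coef x k i * coef x (k + i) j.

Definition triples : seq (nat * nat * nat) :=
  [seq t <- [seq (p, k) | p <- [seq (i, j) | i <- iota 1 n, j <- iota 1 n],
                          k <- iota 1 n]
     | (t.1.1 < t.1.2 < t.2) && (t.1.1 + t.1.2 + t.2 <= n)]%N.

Definition slice_set : seq (nat * nat) :=
  (2, 3)%N :: [seq (1, k)%N | k <- iota 1 n & (1 < k < n)%N].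

Definition law_rels x : seq R := [seq jacobi x t.1.1 t.1.2 t.2 | t <- triples].

Definition slice_rels x : seq R :=
  law_rels x ++ [seq coef x p.1 p.2 - 1 | p <- slice_set].

(* R-points of L_n^T and of L_n^{T, A_n} *)
Definition is_law x : Prop := forall r, r \in law_rels x -> r = 0.
Definition is_slice x : Prop := forall r, r \in slice_rels x -> r = 0.

(* Vectors are rows; the i-th basis vector e_(i+1) is indexed by i : 'I_n.    *)
Definition bracket x (u v : 'rV[R]_n) : 'rV[R]_n :=
  \row_k \sum_(i < n) \sum_(j < n | (i.+1 + j.+1 == k.+1)%N)
     u 0 i * v 0 j * coef x i.+1 j.+1.

(* The linear map u |-> u *m g is a morphism from the law x to the law y.     *)
Definition intertwines x y (g : 'M[R]_n) : Prop :=
  forall u v, bracket x u v *m g = bracket y (u *m g) (v *m g).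

End Laws.

Section Scheme.
Variables (K : fieldType) (n : nat).

Notation pol := {mpoly K[#|{: pair_index n}|]}.

Definition generic : constants n pol := [ffun p => 'X_(enum_rank p)].

Definition eval_at (x : constants n K) (f : pol) : K :=
  meval (fun k => x (enum_val k)) f.

Definition only_one : {pred pol} := pred1 1.
Fact only_one_mulr_closed : mulr_closed only_one.
Proof.
split=> [|a b]; first exact: eqxx.
by move=> /eqP -> /eqP ->; rewrite mulr1; exact: eqxx.
Qed.
HB.instance Definition _ :=
  GRing.isMulClosed.Build pol only_one only_one_mulr_closed.

Definition nonvanishing (x : constants n K) : {pred pol} :=
  [pred f | eval_at x f != 0].
Fact nonvanishing_mulr_closed x : mulr_closed (nonvanishing x).
Proof.
split=> [|a b].
  by change (eval_at x 1 != 0); rewrite /eval_at meval1 oner_neq0.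
change (eval_at x a != 0 -> eval_at x b != 0 -> eval_at x (a * b) != 0).
by rewrite /eval_at mevalM => a0 b0; rewrite mulf_neq0.
Qed.
HB.instance Definition _ x :=
  GRing.isMulClosed.Build pol (nonvanishing x) (nonvanishing_mulr_closed x).

(* K[X]/I, i.e. only 1 is inverted, and the ring of germs at the K-point x,   *)
(* where I is generated by the equations of L_n^{T, A_n}.                     *)
Definition coordinate_ring := localization only_one (slice_rels generic).
Definition local_ring (x : constants n K) :=
  localization (nonvanishing x) (slice_rels generic).
HB.instance Definition _ := GRing.ComPzRing.on coordinate_ring.
HB.instance Definition _ := GRing.Lmodule.on coordinate_ring.
HB.instance Definition _ x := GRing.ComPzRing.on (local_ring x).
HB.instance Definition _ x := GRing.Lmodule.on (local_ring x).

Definition germ (x : constants n K) (f : pol) : local_ring x :=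
  to_loc (nonvanishing x) (slice_rels generic) f.

Definition canonical_deformation (x : constants n K) : constants n (local_ring x) :=
  [ffun p => germ x (generic p)].

Definition trivial_local_ring (x : constants n K) : Prop :=
  bijective (fun c : K => c *: (1 : local_ring x)).

(* The torus T, with weight k on e_k, acting on K[[s]]^n.                     *)
Definition torus (z : K) : 'M[fps K]_n := diag_mx (\row_i fpsC (z ^+ i.+1)).

Definition commutes_with_torus (g : 'M[fps K]_n) : Prop :=
  forall z : K, z != 0 -> g *m torus z = torus z *m g.

(* Reduction modulo s is evaluation of the series at 0; a matrix        *)
(* reducing to the identity is automatically invertible over K[[s]].          *)
Definition rigid (x : constants n K) : Prop :=
  forall X : constants n (fps K), is_law X -> (forall p, X p 0%N = x p) ->
  exists g : 'M[fps K]_n,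
    [/\ map_mx (fun f : fps K => f 0%N) g = 1%:M, commutes_with_torus g
      & intertwines X [ffun p => fpsC (x p)] g].

Definition isomorphic (x y : constants n K) : Prop :=
  exists2 g : 'M[K]_n, g \in unitmx & intertwines x y g.

Definition filiform : constants n K :=
  of_table n (fun i _ => (i <= 2)%N%:R).

Definition witt : constants n K := of_table n (fun i j => j%:R - i%:R).

Definition is_witt_law (x : constants n K) : Prop :=
  is_slice x /\ isomorphic x witt.

(* Meaningful for 0 < i < j. Ring numerals are unary, so 18579, 46608 and     *)
(* 10794 are written 18 * 1000 + 579, etc.                                    *)
Definition filiform_deformation (t : local_ring filiform) (i j : nat) :
    local_ring filiform :=
  let m : K := (i + j)%:R in
  match i, j with
  | 1%N, _ => 1
  | 2%N, 3%N | 2%N, 4%N => 1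
  | 2%N, 5%N => 1 - t
  | 2%N, 6%N => 1 - 2 *: t
  | 2%N, _ => 1 + (6 - m) *: t
            + ((3 * m ^+ 2 - 45 * m + 168) / 4) *: t ^+ 2
            + ((- 4 * m ^+ 3 + 105 * m ^+ 2 - 923 * m + 2712) / 8) *: t ^+ 3
            + ((5 * m ^+ 4 - 192 * m ^+ 3 + 2812 * m ^+ 2 - (18 * 1000 + 579) * m
                + (46 * 1000 + 608)) / 16) *: t ^+ 4
  | 3%N, 4%N | 3%N, 5%N => t
  | 3%N, 6%N => t - (3 / 2) *: t ^+ 2 + (3 / 4) *: t ^+ 3 - (3 / 8) *: t ^+ 4
  | 3%N, 7%N => t - 3 *: t ^+ 2 + (3 / 2) *: t ^+ 3 - (3 / 4) *: t ^+ 4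
  | 3%N, _ => t + (3 / 2 * (8 - m)) *: t ^+ 2
            + ((6 * m ^+ 2 - 111 * m + 516) / 4) *: t ^+ 3
            + ((- 10 * m ^+ 3 + 303 * m ^+ 2 - 3110 * m + (10 * 1000 + 794)) / 8) *: t ^+ 4
  | 4%N, 5%N | 4%N, 6%N => (3 / 2) *: t ^+ 2 - (3 / 4) *: t ^+ 3 + (3 / 8) *: t ^+ 4
  | 4%N, _ => (3 / 2) *: t ^+ 2 + ((- 12 * m + 117) / 4) *: t ^+ 3
            + ((30 * m ^+ 2 - 636 * m + 3423) / 8) *: t ^+ 4
  | 5%N, 6%N | 5%N, 7%N => 3 *: t ^+ 3 - (27 / 4) *: t ^+ 4
  | 5%N, _ => 3 *: t ^+ 3 + ((- 30 * m + 333) / 4) *: t ^+ 4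
  | 6%N, _ => (15 / 2) *: t ^+ 4
  | _, _ => 0
  end.

End Scheme.

(* The value is junk where a denominator occurring for i + j <= n is no unit. *)
Definition family_table (R : comUnitRingType) (t : R) (i j : nat) : R :=
  match i, j with
  | 1%N, _ => 1
  | 2%N, 3%N | 2%N, 4%N => 1
  | 2%N, 5%N => 1 - t
  | 3%N, 4%N => t
  | 2%N, 6%N => 1 - 2 * t
  | 3%N, 5%N => t
  | 2%N, 7%N => (2 - 5 * t) / (2 + t)
  | 3%N, 6%N => (2 * t - 2 * t ^+ 2) / (2 + t)
  | 4%N, 5%N => 3 * t ^+ 2 / (2 + t)
  | 2%N, 8%N => (2 - 7 * t + 5 * t ^+ 2) / (2 + t)
  | 3%N, 7%N => (2 * t - 5 * t ^+ 2) / (2 + t)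
  | 4%N, 6%N => 3 * t ^+ 2 / (2 + t)
  | 2%N, 9%N => (2 - 10 * t + 16 * t ^+ 2 - 5 * t ^+ 3) / (2 * (1 - t ^+ 2))
  | 3%N, 8%N => (4 * t - 16 * t ^+ 2 + 8 * t ^+ 3 - 5 * t ^+ 4)
            / (2 * (2 + t) * (1 - t ^+ 2))
  | 4%N, 7%N => (6 * t ^+ 2 - 12 * t ^+ 3 + 15 * t ^+ 4)
            / (2 * (2 + t) * (1 - t ^+ 2))
  | 5%N, 6%N => (12 * t ^+ 3 - 21 * t ^+ 4) / (2 * (2 + t) * (1 - t ^+ 2))
  | _, _ => 0
  end.

Definition family_law (n : nat) (R : comUnitRingType) (t : R) : constants n R :=
  of_table n (family_table t).

(* Main.v *)
Require Import Defs.
From HB Require Import structures.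
From mathcomp Require Import all_boot all_order all_algebra.
From mathcomp Require Import boolp generic_quotient mpoly qpoly.
From mathcomp Require Import ring zify.

Set Implicit Arguments.
Unset Strict Implicit.
Unset Printing Implicit Defensive.

Import GRing.Theory.
Local Open Scope ring_scope.

(** The Jacobi identities involving e_1 give X_jk = X_(j+1,k) + X_(j,k+1), which
    leaves at most one unknown in each weight, and none in even weights. In odd
    weight q + 5 >= 9 the identity for (2, 3, q) determines this unknown when
    1 + X_2q + X_3q is a nonzerodivisor. A point of the slice over any ring is
    then determined by t = X_34. Weights 9 and 11 force 2 + t and 1 - t^2 to be
    units, and weight 12 yields t^5 (10 t - 1) = 0, which separates f_n (t = 0)
    from w_n (t = 1/10). Applied to the tautological point of a local ring, this
    gives t = 1/10 at w_n and t^5 = 0 at f_n; the explicit law over K[X]/(X^5)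
    shows that there is no further relation at f_n. Applied to K[[s]]-points,
    which can be normalized by diagonal matrices, it gives rigidity. *)

(** Uniqueness is proved over an arbitrary commutative ring so that one lemma serves for points over
    K, over K-algebras, over local rings and over K[[s]]: it then remains to exhibit a law with the
    right t whose elements 1 + X_2q + X_3q are nonzerodivisors. Explicit formulas are thus verified,
    never derived. The element 1 + X_2q + X_3q comes from subtracting the (2, 3, q) identities of
    two points that agree in lower weights: if they differ by d at X_(2,q+3), the recursion makes
    them differ by -d at X_(3,q+2) and at X_(5,q), whence d (1 + X_2q + X_3q) = 0. For f_n, all n
    can be treated at once because the table in u = t/2 has integer coefficients and only six
    nonzero rows, so that Jacobi splits into finitely many polynomial identities modulo u^5. The
    nilpotent germ does not obstruct the rigidity of f_n, since K[[s]] is reduced. *)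

Section Coefficients.
Variables (n : nat) (R : comPzRingType).
Implicit Types x y : constants n R.

Lemma mem_pair_index i j :
  ((i, j) \in pair_index_seq n) = [&& 0 < i, i < j & i + j <= n]%N.
Proof.
rewrite mem_filter.
apply/andP/and3P => /= [[/andP[ij ijn]]|[i0 ij ijn]].
  case/allpairsP=> -[a b] /= [+ + [ia jb]]; rewrite {}ia {}jb !mem_iota in ij ijn *.
  by move=> a1 b1; split; lia.
split; first by rewrite ij.
by apply/allpairsP; exists (i, j); split=> //=; rewrite mem_iota; lia.
Qed.

Lemma coef_seq_sub x i j (ij : (i, j) \in pair_index_seq n) :
  coef x i j = x (SeqSub ij).
Proof.
rewrite /coef; case: insubP => [p _ pE|/negP//].
by congr (x _); apply/val_inj; rewrite /= -pE.
Qed.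

Lemma coef_swap x i j : coef x i j = - coef x j i.
Proof.
rewrite /coef; case: insubP => [p pin _|_]; last first.
  by case: insubP => [p _ _|_]; rewrite ?opprK ?oppr0.
case: insubP => [q qin _|_]; last by rewrite opprK.
by move: pin qin; rewrite !mem_pair_index; lia.
Qed.

Lemma coef_out x i j :
  ~~ [&& 0 < i, 0 < j, i != j & i + j <= n]%N -> coef x i j = 0.
Proof.
move=> nij; rewrite /coef; case: insubP => [p + _|_].
  by rewrite mem_pair_index; lia.
by case: insubP => [q + _|_] //; rewrite mem_pair_index; lia.
Qed.

Lemma coef_diag x i : coef x i i = 0.
Proof. by rewrite coef_out // eqxx /= !andbF. Qed.

Lemma coef_of_table (c : nat -> nat -> R) i j :
  (0 < i < j)%N -> (i + j <= n)%N -> coef (of_table n c) i j = c i j.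
Proof.
move=> ij ijn; have ijP : (i, j) \in pair_index_seq n by rewrite mem_pair_index; lia.
by rewrite (coef_seq_sub _ ijP) ffunE.
Qed.

Lemma constants_ext x y :
    (forall i j, (0 < i < j)%N -> (i + j <= n)%N -> coef x i j = coef y i j) ->
  x = y.
Proof.
move=> xy; apply/ffunP => -[[i j] ijP].
have ijn := ijP; rewrite mem_pair_index in ijn.
by have := xy i j; rewrite !(coef_seq_sub _ ijP); apply; lia.
Qed.

Lemma isLawP x : is_law x <->
  forall i j k, (0 < i < j)%N -> (j < k)%N -> (i + j + k <= n)%N -> jacobi x i j k = 0.
Proof.
split=> [xL i j k ij jk ijk|xJ r /mapP[[[i j] k] + ->]].
  apply: xL; apply/mapP; exists (i, j, k) => //.
  rewrite mem_filter /=; apply/andP; split; first by lia.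
  apply/allpairsP; exists ((i, j), k); split=> //; last first.
    by rewrite mem_iota /=; move: ij jk ijk; clear; lia.
  by apply/allpairsP; exists (i, j); split=> //=; rewrite mem_iota; move: ij jk ijk; clear; lia.
rewrite mem_filter => /andP[/= /andP[ijk ijkn]].
case/allpairsP => -[p c] /= [/allpairsP[[a b] /= [ain _ ->]] _ [ia jb kc]].
move: ain; rewrite mem_iota -ia => i1.
by apply: xJ; lia.
Qed.

Lemma isSliceP x : is_slice x <->
  [/\ forall i j k, (0 < i < j)%N -> (j < k)%N -> (i + j + k <= n)%N -> jacobi x i j k = 0,
      coef x 2 3 = 1
    & forall k, (1 < k < n)%N -> coef x 1 k = 1].
Proof.
split=> [xS|[xJ x23 x1k]].
  split.
  - by apply/isLawP => r rx; apply: xS; rewrite mem_cat rx.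
  - apply/eqP; rewrite -subr_eq0; apply/eqP; apply: xS.
    by rewrite mem_cat inE eqxx orbT.
  - move=> k kn; apply/eqP; rewrite -subr_eq0; apply/eqP; apply: xS.
    rewrite mem_cat; apply/orP; right; apply/mapP; exists (1, k)%N => //.
    by rewrite inE; apply/orP; right; rewrite map_f // mem_filter mem_iota; lia.
move=> r; rewrite mem_cat => /orP[|/mapP[p + ->]].
  by move: r; apply/isLawP.
rewrite inE => /orP[/eqP->|/mapP[k + ->]]; first by rewrite x23 subrr.
by rewrite mem_filter => /andP[kn _]; rewrite x1k ?subrr.
Qed.

(* Jacobi for the triple (1, j, k): ad e_1 acts as a derivation. *)
Lemma slice_rec x j k : is_slice x -> (1 < j)%N -> (1 < k)%N -> (j + k < n)%N ->
  coef x j k = coef x j.+1 k + coef x j k.+1.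
Proof.
case/isSliceP => xJ _ x1k.
wlog lejk : j k / (j <= k)%N => [th j1 k1 jkn|].
  case/orP: (leq_total j k) => jk; first exact: th.
  rewrite (coef_swap _ j.+1) (coef_swap _ _ k.+1) coef_swap addrC -opprD -th //; lia.
move=> j1 k1 jkn; case: (eqVneq j k) lejk => [<- _|njk lejk].
  by rewrite coef_diag (coef_swap x j.+1) addNr.
have := xJ 1%N j k.
rewrite /jacobi (coef_swap _ (j + k) 1) (coef_swap _ k 1) (coef_swap _ (k + 1) j).
rewrite !x1k ?[(1 + _)%N]add1n ?addn1; try lia.
move=> /(_ _ _ _) E; apply/eqP; rewrite -subr_eq0.
suff -> : coef x j k - (coef x j.+1 k + coef x j k.+1) =
   - (1 * coef x j.+1 k + coef x j k * -1 + -1 * - coef x j k.+1) by rewrite E ?oppr0 //; lia.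
by ring.
Qed.

End Coefficients.

Lemma coef_rmorph n (R S : comPzRingType) (f : {rmorphism R -> S}) (x : constants n R) i j :
  coef [ffun p => f (x p)] i j = f (coef x i j).
Proof.
rewrite /coef; case: insubP => [p _ _|_]; rewrite ?ffunE //.
by case: insubP => [p _ _|_]; rewrite ?ffunE ?rmorphN ?rmorph0.
Qed.

Lemma jacobi_rmorph n (R S : comPzRingType) (f : {rmorphism R -> S}) (x : constants n R) i j k :
  jacobi [ffun p => f (x p)] i j k = f (jacobi x i j k).
Proof. by rewrite /jacobi !coef_rmorph !(rmorphD, rmorphM). Qed.

Lemma is_slice_rmorph n (R S : comPzRingType) (f : {rmorphism R -> S}) (x : constants n R) :
  is_slice x -> is_slice [ffun p => f (x p)].
Proof.
case/isSliceP => xJ x23 x1k; apply/isSliceP; split=> [i j k ij jk ijk||k kn].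
- by rewrite jacobi_rmorph xJ ?rmorph0.
- by rewrite coef_rmorph x23 rmorph1.
- by rewrite coef_rmorph x1k ?rmorph1.
Qed.
Arguments is_slice_rmorph {n R S} f {x}.

(** Certificate form of a deduction: the multiplier [c] is given by hand, and the remaining
    identity, free of hypotheses, is left to [ring]. *)
Lemma eq_of_lincomb (R : pzRingType) (c a b l r : R) :
  l = r -> a - b = c * (l - r) -> a = b.
Proof. by move=> ->; rewrite subrr mulr0 => /eqP; rewrite subr_eq0 => /eqP. Qed.
Arguments eq_of_lincomb {R} c {a b l r}.

(** * A point of the slice is determined by X_34 *)

Section Uniqueness.
Variables (n : nat) (R : comPzRingType).
Implicit Types x y : constants n R.

Lemma slice_coef1 x k : is_slice x -> coef x 1 k = (1 < k < n)%N%:R.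
Proof.
case/isSliceP => _ _ x1k; case: (boolP (1 < k < n)%N) => [/x1k //|nk].
by rewrite coef_out //; move: nk; clear; lia.
Qed.

(** Since X_23 = 1, the identity for (2, 3, q) is linear in the constants of weight q + 5, with
    coefficients of lower weight. *)
Lemma slice_jacobi23 x q : is_slice x -> (3 < q)%N -> (q + 5 <= n)%N ->
  coef x 5 q = coef x 3 q * coef x 2 (3 + q) - coef x 2 q * coef x 3 (q + 2).
Proof.
case/isSliceP => xJ x23 _ q3 qn.
have := xJ 2%N 3%N q isT q3; rewrite addnC => /(_ qn).
rewrite /jacobi x23 (coef_swap _ (3 + q) 2) (coef_swap _ q 2) (coef_swap _ (q + 2) 3).
by move=> E; apply: (eq_of_lincomb 1 E); ring.
Qed.

(* In weight [m] the recursion leaves one unknown up to sign, which is zero   *)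
(* for even [m] and determined by the Jacobi identity for (2, 3, m - 5) when  *)
(* [m >= 9] is odd.                                                           *)
Lemma slice_unique x y : is_slice x -> is_slice y -> coef x 3 4 = coef y 3 4 ->
    (forall q d, (4 <= q)%N -> (q + 5 <= n)%N ->
       d * (1 + coef y 2 q + coef y 3 q) = 0 -> d = 0) ->
  x = y.
Proof.
move=> xS yS xy34 reg.
have [xJ x23 _] := (isSliceP x).1 xS; have [yJ y23 _] := (isSliceP y).1 yS.
suff E m i j : (i + j = m)%N -> (m <= n)%N -> coef x i j = coef y i j.
  by apply: constants_ext => i j _; exact: E.
elim/ltn_ind: m i j => m IH i j ijm mn.
have {}IH a b : (a + b < m)%N -> coef x a b = coef y a b.
  by move=> abm; apply: (IH (a + b)%N) => //; lia.
have C1 k : coef x 1 k = coef y 1 k by rewrite !slice_coef1.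
have C0 k : coef x 0 k = coef y 0 k by rewrite !coef_out.
wlog [i2 j2] : i j ijm / (1 < i)%N /\ (1 < j)%N => [th|].
  case: i ijm => [|[|i]] ijm; rewrite ?C1 ?C0 //.
  case: j ijm => [|[|j]] ijm; last exact: th.
    by rewrite coef_swap [RHS]coef_swap !C0.
  by rewrite coef_swap [RHS]coef_swap !C1.
pose d k := coef x k (m - k) - coef y k (m - k).
have dS k : (1 < k)%N -> (k + 2 < m)%N -> d k.+1 = - d k.
  move=> k1 km; rewrite /d.
  have [h1 h2] : (1 < m - k.+1)%N /\ (k + (m - k.+1) < m)%N by lia.
  have h3 := leq_trans h2 mn; have := IH k (m - k.+1)%N h2.
  rewrite (slice_rec xS k1 h1 h3) (slice_rec yS k1 h1 h3).
  have -> : (m - k.+1).+1 = (m - k)%N by lia.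
  by move=> E; apply: (eq_of_lincomb 1 E); ring.
have d2 k : d k.+2 = 0 -> (k.+3 < m)%N -> d 2%N = 0.
  elim: k => [//|k IHk] dk km; apply: IHk; last by lia.
  by apply/eqP; rewrite -oppr_eq0 -dS ?dk //; lia.
suff d20 : d 2%N = 0.
  apply/eqP; rewrite -subr_eq0; have -> : j = (m - i)%N by lia.
  rewrite -/(d i); case: i i2 ijm => [|[|i]] // _ ijm.
  have : (i.+2 + 2 <= m)%N by lia.
  elim: i {ijm} => [|i IHi] im; first by rewrite d20.
  by rewrite dS ?oppr_eq0 ?IHi //; lia.
have m4 : (4 <= m)%N by lia.
case: (boolP (odd m)) => mo; last first.
  (* In even weight the middle difference, at (m/2, m/2), is zero by antisymmetry, and [d2] carries
     the vanishing back to [d 2]. *)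
  apply: (d2 (m./2 - 2)%N); last by lia.
  by rewrite /d (_ : (m - _)%N = (m./2 - 2).+2) ?coef_diag ?subrr //; lia.
case: (ltnP m 9) => m9.
  have [m5|m7] : m = 5%N \/ m = 7%N by lia.
    by rewrite /d m5 x23 y23 subrr.
  by apply: (d2 1%N); rewrite /d m7 ?xy34 ?subrr.
pose q := (m - 5)%N.
apply: (reg q); rewrite /q; try lia.
have d3 : d 3%N = - d 2%N by apply: dS; lia.
have d5 : d 5%N = - d 2%N by rewrite dS ?(dS 3%N) ?d3 ?opprK //; lia.
have q3 : (3 < q)%N by rewrite /q; lia.
have qn : (q + 5 <= n)%N by rewrite /q; lia.
move: d3 d5; rewrite /d.
have -> : (m - 2 = 3 + q)%N by rewrite /q; lia.
have -> : (m - 3 = q + 2)%N by rewrite /q; lia.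
rewrite -/q (slice_jacobi23 xS) ?(slice_jacobi23 yS) //.
rewrite (IH 3%N q) ?(IH 2%N q); try (rewrite /q; lia).
move=> d3 d5.
have {}d3 : coef x 3 (q + 2) = coef y 3 (q + 2) - (coef x 2 (3 + q) - coef y 2 (3 + q)).
  by apply: (eq_of_lincomb 1 d3); ring.
by apply: (eq_of_lincomb 1 d5); rewrite d3; ring.
Qed.

End Uniqueness.

(** * Relations up to weight 12, with X_34, X_45, X_56 as the unknowns of weights 7, 9, 11 *)

Section LowWeights.
Variables (n : nat) (R : comPzRingType) (x : constants n R).
Hypothesis xS : is_slice x.
Notation t := (coef x 3 4).
Notation a := (coef x 4 5).
Notation b := (coef x 5 6).

Let rec j k (j1 : (1 < j)%N) (k1 : (1 < k)%N) (jkn : (j + k < n)%N) :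
  coef x j k.+1 = coef x j k - coef x j.+1 k.
Proof. by apply: (eq_of_lincomb (-1) (slice_rec xS j1 k1 jkn)); ring. Qed.

Let x23 : coef x 2 3 = 1. Proof. by case/isSliceP: xS. Qed.
Let x24 : (6 <= n)%N -> coef x 2 4 = 1.
Proof. by move=> n6; rewrite rec // x23 coef_diag subr0. Qed.
Let x25 : (7 <= n)%N -> coef x 2 5 = 1 - t.
Proof. by move=> n7; rewrite rec // x24 ?(ltnW n7). Qed.
Let x35 : (8 <= n)%N -> coef x 3 5 = t.
Proof. by move=> n8; rewrite rec // coef_diag subr0. Qed.
Let x26 : (8 <= n)%N -> coef x 2 6 = 1 - 2 * t.
Proof. by move=> n8; rewrite rec // x25 ?x35 ?(ltnW n8) //; ring. Qed.
Let x36 : (9 <= n)%N -> coef x 3 6 = t - a.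
Proof. by move=> n9; rewrite rec // x35 // ltnW. Qed.
Let x27 : (9 <= n)%N -> coef x 2 7 = 1 - 3 * t + a.
Proof. by move=> n9; rewrite rec // x26 ?x36 ?(ltnW n9) //; ring. Qed.
Let x46 : (10 <= n)%N -> coef x 4 6 = a.
Proof. by move=> n10; rewrite rec // coef_diag subr0. Qed.
Let x37 : (10 <= n)%N -> coef x 3 7 = t - 2 * a.
Proof. by move=> n10; rewrite rec // x36 ?x46 ?(ltnW n10) //; ring. Qed.
Let x28 : (10 <= n)%N -> coef x 2 8 = 1 - 4 * t + 3 * a.
Proof. by move=> n10; rewrite rec // x27 ?x37 ?(ltnW n10) //; ring. Qed.
Let x47 : (11 <= n)%N -> coef x 4 7 = a - b.
Proof. by move=> n11; rewrite rec // x46 // ltnW. Qed.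
Let x38 : (11 <= n)%N -> coef x 3 8 = t - 3 * a + b.
Proof. by move=> n11; rewrite rec // x37 ?x47 ?(ltnW n11) //; ring. Qed.
Let x29 : (11 <= n)%N -> coef x 2 9 = 1 - 5 * t + 6 * a - b.
Proof. by move=> n11; rewrite rec // x28 ?x38 ?(ltnW n11) //; ring. Qed.
Let x57 : (12 <= n)%N -> coef x 5 7 = b.
Proof. by move=> n12; rewrite rec // coef_diag subr0. Qed.
Let x48 : (12 <= n)%N -> coef x 4 8 = a - 2 * b.
Proof. by move=> n12; rewrite rec // x47 ?x57 ?(ltnW n12) //; ring. Qed.
Let x39 : (12 <= n)%N -> coef x 3 9 = t - 4 * a + 3 * b.
Proof. by move=> n12; rewrite rec // x38 ?x48 ?(ltnW n12) //; ring. Qed.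

Lemma slice_weight9 : (9 <= n)%N -> (2 + t) * a = 3 * t ^+ 2.
Proof.
move=> n9; have n8 := ltnW n9; have n7 := ltnW n8; have n6 := ltnW n7.
have := slice_jacobi23 xS (isT : 3 < 4)%N n9.
rewrite (coef_swap _ 5 4) [(3 + 4)%N]/= [(4 + 2)%N]/= x27 // x24 // x36 // => E.
by apply: (eq_of_lincomb (-1) E); ring.
Qed.

Lemma slice_weight11 : (11 <= n)%N ->
  4 * (2 + t) * (1 - t ^+ 2) * b = 24 * t ^+ 3 - 42 * t ^+ 4.
Proof.
move=> n11; have n10 := ltnW n11; have n9 := ltnW n10; have n8 := ltnW n9.
have := slice_jacobi23 xS (isT : 3 < 6)%N n11.
rewrite [(3 + 6)%N]/= [(6 + 2)%N]/= x29 // x36 // x26 // x38 // => E.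
have A := slice_weight9 n9.
have F : (2 - t - a) * b = 4 * a * t - 6 * a ^+ 2.
  have := congr2 +%R E A => {}E.
  by apply: (eq_of_lincomb 1 E); ring.
(* Multiplication by 2 + t removes [a] from the coefficient of [b]: by weight 9, (2 + t) (2 - t - a)
   = 4 (1 - t^2). This is where the excluded values 1 and -1 come from. *)
have G : 4 * (1 - t ^+ 2) * b = 12 * t ^+ 3 - 18 * a * t ^+ 2.
  have := congr2 (fun u v => (2 + t) * u + (b + 4 * t - 6 * a) * v) F A => H.
  by apply: (eq_of_lincomb 1 H); ring.
have := congr2 (fun u v => (2 + t) * u - 18 * t ^+ 2 * v) G A => H.
by apply: (eq_of_lincomb 1 H); ring.
Qed.

(** Weight 12 is even and brings no new unknown, so the identity for (3, 4, 5) is a condition on t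
    alone. It reads 4 a^2 - 3 a b - 3 t b = 0; the multiplier 4 (2 + t)^2 (1 - t^2) then allows [a]
    and [b] to be eliminated by weights 9 and 11. *)
Lemma slice_weight12 : (12 <= n)%N -> 36 * t ^+ 5 * (10 * t - 1) = 0.
Proof.
move=> n12; have n11 := ltnW n12; have n10 := ltnW n11; have n9 := ltnW n10.
have n8 := ltnW n9.
have A := slice_weight9 n9; have B := slice_weight11 n11.
have C : 4 * a ^+ 2 - 3 * a * b - 3 * t * b = 0.
  case/isSliceP: (xS) => /(_ 3%N 4%N 5%N isT isT n12) + _ _.
  rewrite /jacobi (coef_swap _ (3 + 4) 5) (coef_swap _ (4 + 5) 3) (coef_swap _ 5 3).
  rewrite (coef_swap _ (5 + 3) 4) x57 // x39 // x48 // x35 // => E.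
  by apply: (eq_of_lincomb 1 E); ring.
have : 4 * (2 + t) ^+ 2 * (1 - t ^+ 2) * (4 * a ^+ 2 - 3 * a * b - 3 * t * b) =
    16 * (1 - t ^+ 2) * ((2 + t) * a) ^+ 2
    - 3 * ((2 + t) * a) * (4 * (2 + t) * (1 - t ^+ 2) * b)
    - 3 * t * (2 + t) * (4 * (2 + t) * (1 - t ^+ 2) * b) by ring.
by rewrite A B C => H; apply: (eq_of_lincomb (-1) H); ring.
Qed.

End LowWeights.

(** * Laws given by tables *)

Section Tables.
Variables (n : nat) (R : comPzRingType) (c : nat -> nat -> R).

(** Antisymmetric extension with no bound on i + j, in contrast with [coef], so that Jacobi
    identities of a table can be checked independently of n. *)
Definition alternate i j : R :=
  if (i < j)%N then c i j else if (j < i)%N then - c j i else 0.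

Lemma coef_of_table_alternate i j : (0 < i)%N -> (0 < j)%N -> (i + j <= n)%N ->
  coef (of_table n c) i j = alternate i j.
Proof.
move=> i0 j0 ijn; rewrite /alternate; case: ltngtP => [ij|ji|->].
- by rewrite coef_of_table // i0.
- by rewrite coef_swap coef_of_table ?j0 // addnC.
- exact: coef_diag.
Qed.

(** For i < j < k the pairs (i, j + k) and (j, i + k) are already increasing; only (i + j, k) has an
    unknown order, hence the single [alternate] in the Jacobi condition. *)
Lemma table_slice : (5 <= n)%N -> (forall k, (1 < k)%N -> c 1 k = 1) -> c 2 3 = 1 ->
    (forall i j k, (0 < i < j)%N -> (j < k)%N -> (i + j + k <= n)%N ->
       c i j * alternate (i + j) k - c j k * c i (j + k)%N + c i k * c j (i + k)%N = 0) ->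
  is_slice (of_table n c).
Proof.
move=> n5 c1 c23 cJ; apply/isSliceP; split=> [i j k ij jk ijk||k kn].
- rewrite /jacobi (coef_swap _ (j + k)) (coef_swap _ k i) (coef_swap _ (k + i)).
  rewrite (coef_of_table_alternate (_ : 0 < i + j)%N); try lia.
  rewrite !coef_of_table; try lia.
  by rewrite (addnC k i) mulrNN mulrN; apply: cJ.
- by rewrite coef_of_table.
- by case/andP: kn => k1 kn; rewrite coef_of_table ?c1 ?k1.
Qed.

End Tables.

(** * The continuous family for n between 7 and 11 *)

Section Family.
Variable R : comPzRingType.
Implicit Types t a b : R.

(** Division-free form of the family: the unknowns of weights 9 and 11 are kept as parameters [a]
    and [b], and the recursion gives the rest. *)
Definition family_coef t a b (i j : nat) : R :=
  match i, j with
  | 1%N, _ | 2%N, 3%N | 2%N, 4%N => 1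
  | 2%N, 5%N => 1 - t
  | 2%N, 6%N => 1 - 2 * t
  | 2%N, 7%N => 1 - 3 * t + a
  | 2%N, 8%N => 1 - 4 * t + 3 * a
  | 2%N, 9%N => 1 - 5 * t + 6 * a - b
  | 3%N, 4%N | 3%N, 5%N => t
  | 3%N, 6%N => t - a
  | 3%N, 7%N => t - 2 * a
  | 3%N, 8%N => t - 3 * a + b
  | 4%N, 5%N | 4%N, 6%N => a
  | 4%N, 7%N => a - b
  | 5%N, 6%N => b
  | _, _ => 0
  end.

Lemma family_coef_slice n t a b : (5 <= n <= 11)%N ->
    ((9 <= n)%N -> (2 + t) * a = 3 * t ^+ 2) ->
    ((11 <= n)%N -> (2 - t - a) * b = 4 * a * t - 6 * a ^+ 2) ->
  is_slice (of_table n (family_coef t a b)).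
Proof.
move=> n5_11 A B; apply: table_slice => // [|i j k ij jk ijk]; first by lia.
have i3 : (i < 3)%N by lia.
have j5 : (j < 5)%N by lia.
have k9 : (k < 9)%N by lia.
move: i3 j5 k9 ij jk ijk.
case: i => [|[|[|i]]] // _; case: j => [|[|[|[|[|j]]]]] // _;
  case: k => [|[|[|[|[|[|[|[|[|k]]]]]]]]] // _ _ _ ijk;
  try (by move: (leq_trans ijk (proj2 (andP n5_11)))); rewrite /alternate /=;
  try (by ring).
(* Triples containing 1 hold identically. The four goals left are (2, 3, 4), (2, 3, 5), (2, 3, 6)
   and (2, 4, 5). *)
- by apply: (eq_of_lincomb (-1) (A ijk)); ring.
- by apply: (eq_of_lincomb (-1) (A (ltnW ijk))); ring.
- have A' := A (ltnW (ltnW ijk)); have B' := B ijk.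
  by have := congr2 (fun u v => v - u) A' B' => E;
    apply: (eq_of_lincomb 1 E); ring.
- by apply: (eq_of_lincomb (-1) (B ijk)); ring.
Qed.

End Family.

Lemma divr_eq_of_unit (R : comUnitRingType) (e x d y : R) :
  e \is a GRing.unit -> d \is a GRing.unit -> e * (x - y * d) = 0 -> x / d = y.
Proof.
move=> eU dU exy; apply: (mulIr dU); rewrite mulrVK //; apply/eqP.
by rewrite -subr_eq0 -(mulrI_eq0 _ (mulrI eU)) exy.
Qed.

Lemma eq_of_lincomb2 (R : pzRingType) (c d a b l r l' r' : R) :
  l = r -> l' = r' -> a - b = c * (l - r) + d * (l' - r') -> a = b.
Proof. by move=> -> -> E; apply: (eq_of_lincomb 1 (erefl 0)); rewrite E !subrr !mulr0 addr0. Qed.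
Arguments eq_of_lincomb2 {R} c d {a b l r l' r'}.

Section FamilyLaw.
Variable R : comUnitRingType.
Hypothesis natU : forall m, (0 < m)%N -> (m%:R : R) \is a GRing.unit.
Implicit Types t a b : R.

Lemma family_law_coef n t :
    (n <= 11)%N -> ((9 <= n)%N -> 2 + t \is a GRing.unit) ->
    ((11 <= n)%N -> 1 - t ^+ 2 \is a GRing.unit) ->
  family_law n t = of_table n (family_coef t (3 * t ^+ 2 / (2 + t))
    ((12 * t ^+ 3 - 21 * t ^+ 4) / (2 * (2 + t) * (1 - t ^+ 2)))).
Proof.
move=> n11 tU9 tU11; apply: constants_ext => i j ij ijn.
rewrite !coef_of_table //.
have A : (9 <= n)%N -> (2 + t) * (3 * t ^+ 2 / (2 + t)) = 3 * t ^+ 2.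
  by move=> /tU9 tU; rewrite mulrC mulrVK.
have d9 : (11 <= n)%N -> 2 * (1 - t ^+ 2) \is a GRing.unit.
  by move=> /tU11 tU; rewrite unitrM natU.
have d11 : (11 <= n)%N -> 2 * (2 + t) * (1 - t ^+ 2) \is a GRing.unit.
  by move=> n_11; rewrite !unitrM natU // tU9 ?tU11 //; exact: leq_trans n_11.
have B : (11 <= n)%N -> (2 * (2 + t) * (1 - t ^+ 2)) *
    ((12 * t ^+ 3 - 21 * t ^+ 4) / (2 * (2 + t) * (1 - t ^+ 2)))
    = 12 * t ^+ 3 - 21 * t ^+ 4.
  by move=> /d11 dU; rewrite mulrC mulrVK.
(* From here on the two fractions are known only through the equations [A] and [B], which keeps the
   certificates polynomial. *)
move: (3 * t ^+ 2 / (2 + t)) ((_ - _) / _) A B => a b A B.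
have i6 : (i < 6)%N by lia.
case: (eqVneq i 1%N) => [->|i1] //.
have j10 : (j < 10)%N by lia.
move: i6 j10 ij ijn {i1}.
case: i => [|[|[|[|[|[|i]]]]]] // _; case: j => [|[|[|[|[|[|[|[|[|[|j]]]]]]]]]] // _ _ ijn;
  try (by move: (leq_trans ijn n11)); rewrite /=.
- by apply: (divr_eq_of_unit (unitr1 R) (tU9 ijn)); apply: (eq_of_lincomb (-1) (A ijn)); ring.
- by apply: (divr_eq_of_unit (unitr1 R) (tU9 (ltnW ijn)));
    apply: (eq_of_lincomb (-3) (A (ltnW ijn))); ring.
- apply: (divr_eq_of_unit (tU9 (ltnW (ltnW ijn))) (d9 ijn)).
  by apply: (eq_of_lincomb2 (- 12 * (1 - t ^+ 2)) (1) (A (ltnW (ltnW ijn))) (B ijn)); ring.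
- by apply: (divr_eq_of_unit (unitr1 R) (tU9 ijn)); apply: (eq_of_lincomb 1 (A ijn)); ring.
- by apply: (divr_eq_of_unit (unitr1 R) (tU9 (ltnW ijn)));
    apply: (eq_of_lincomb 2 (A (ltnW ijn))); ring.
- apply: (divr_eq_of_unit (unitr1 R) (d11 ijn)).
  by apply: (eq_of_lincomb2 (6 * (1 - t ^+ 2)) (-1) (A (ltnW (ltnW ijn))) (B ijn)); ring.
- by apply: (divr_eq_of_unit (unitr1 R) (tU9 ijn)); apply: (eq_of_lincomb (-1) (A ijn)); ring.
- by apply: (divr_eq_of_unit (unitr1 R) (tU9 (ltnW ijn)));
    apply: (eq_of_lincomb (-1) (A (ltnW ijn))); ring.
- apply: (divr_eq_of_unit (unitr1 R) (d11 ijn)).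
  by apply: (eq_of_lincomb2 (- 2 * (1 - t ^+ 2)) (1) (A (ltnW (ltnW ijn))) (B ijn)); ring.
- by apply: (divr_eq_of_unit (unitr1 R) (d11 ijn)); apply: (eq_of_lincomb (-1) (B ijn)); ring.
Qed.

Lemma family_law_slice n t :
    (5 <= n <= 11)%N -> ((9 <= n)%N -> 2 + t \is a GRing.unit) ->
    ((11 <= n)%N -> 1 - t ^+ 2 \is a GRing.unit) ->
  is_slice (family_law n t).
Proof.
move=> n5_11 tU9 tU11; have /andP[_ n11] := n5_11.
rewrite family_law_coef //; apply: family_coef_slice => // [/tU9 tU|n_11].
  by rewrite mulrC mulrVK.
have tU := tU9 (ltnW (ltnW n_11)).
have dU : 2 * (2 + t) * (1 - t ^+ 2) \is a GRing.unit.
  by rewrite !unitrM natU // tU tU11.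
set a := 3 * _ / _; set b := (12 * _ - _) / _.
have A : (2 + t) * a = 3 * t ^+ 2 by rewrite mulrC mulrVK.
have B : (2 * (2 + t) * (1 - t ^+ 2)) * b = 12 * t ^+ 3 - 21 * t ^+ 4.
  by rewrite mulrC mulrVK.
apply: (mulrI tU); apply: (mulrI tU).
by apply: (eq_of_lincomb2 (6 * ((2 + t) * a + 3 * t ^+ 2) - (2 + t) * (b + 4 * t)) 2 A B); ring.
Qed.

(** At t = -2 the weight 9 equation would read 0 = 12; explicitly, (2 + t) (X_45 - 3 (t - 2)) =
    12. *)
Lemma slice_unit9 n (y : constants n R) (t := coef y 3 4) :
  is_slice y -> (9 <= n)%N -> 2 + t \is a GRing.unit.
Proof.
move=> yS n9; have E := slice_weight9 yS n9; rewrite -/t in E.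
suff : (2 + t) * (coef y 4 5 - 3 * (t - 2)) \is a GRing.unit by rewrite unitrM => /andP[].
rewrite (_ : _ * _ = 12) ?natU //.
by apply: (eq_of_lincomb 1 E); ring.
Qed.

(** Modulo 1 - t^2 the weight 11 equation becomes 0 = 24 t - 42, and (24 t - 42) (24 t + 42) is then
    576 - 1764 = - 11 * 108, a unit. The cofactor [z] records this computation. *)
Lemma slice_unit11 n (y : constants n R) (t := coef y 3 4) :
  is_slice y -> (11 <= n)%N -> 1 - t ^+ 2 \is a GRing.unit.
Proof.
move=> yS n11; have E := slice_weight11 yS n11; rewrite -/t in E.
pose z := (4 * (2 + t) * coef y 5 6 + 24 * t - 42 * t ^+ 2 - 42) * (24 * t + 42) + 576.
suff : (1 - t ^+ 2) * z \is a GRing.unit by rewrite unitrM => /andP[].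
rewrite (_ : _ * _ = - (11 * 108)) ?unitrN ?unitrM ?natU //.
by apply: (eq_of_lincomb (24 * t + 42) E); rewrite /z; ring.
Qed.

Lemma slice_familyP n (y : constants n R) : (7 <= n <= 11)%N ->
  is_slice y <-> exists t,
    [/\ (9 <= n)%N -> t + 2 \is a GRing.unit,
        (11 <= n)%N -> (t - 1 \is a GRing.unit) /\ (t + 1 \is a GRing.unit)
      & y = family_law n t].
Proof.
move=> n7_11; have n5_11 : (5 <= n <= 11)%N by lia.
have factor t : 1 - t ^+ 2 = - ((t - 1) * (t + 1)) by ring.
split=> [yS|[t [tU9 tU11 ->]]]; last first.
  apply: family_law_slice => // [/tU9|/tU11[tU1 tU2]]; first by rewrite addrC.
  by rewrite factor unitrN unitrM tU1.
have tU9 := slice_unit9 yS; have tU11 := slice_unit11 yS.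
set t := coef y 3 4 in tU9 tU11; exists t; split.
- by move=> /tU9; rewrite addrC.
- by move=> /tU11; rewrite factor unitrN unitrM => /andP.
apply: (slice_unique yS (family_law_slice n5_11 tU9 tU11)).
  by rewrite coef_of_table //; lia.
have [_ n11] := andP n7_11.
rewrite family_law_coef // => q d q4 qn; rewrite !coef_of_table; try lia.
(* For q = 4, 5, 6 the element 1 + X_2q + X_3q is 2 + t, 2 and 4 (1 - t^2) / (2 + t), each a
   unit. *)
have : q = 4%N \/ q = 5%N \/ q = 6%N by lia.
move=> [|[|]] q_; subst q => /=.
- rewrite (_ : 1 + 1 + t = 2 + t) ?[2 + t]addrA //.
  by move=> /eqP; rewrite (mulIr_eq0 _ (mulIr (tU9 qn))) => /eqP.
- rewrite (_ : 1 + (1 - t) + t = 2); last by ring.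
  by move=> /eqP; rewrite (mulIr_eq0 _ (mulIr (natU (isT : 0 < 2)%N))) => /eqP.
- have t9 := tU9 (ltnW (ltnW qn)).
  rewrite (_ : 1 + _ + _ = 4 * (1 - t ^+ 2) / (2 + t)).
    move=> /eqP; rewrite mulIr_eq0 => [/eqP //|]; apply: mulIr.
    by rewrite !unitrM unitrV natU // t9 tU11.
  apply/esym/(divr_eq_of_unit (unitr1 R) t9).
  have A : (2 + t) * (3 * t ^+ 2 / (2 + t)) = 3 * t ^+ 2 by rewrite mulrC mulrVK.
  by apply: (eq_of_lincomb 1 A); ring.
Qed.

End FamilyLaw.

(** * The deformed filiform law over a ring with u^5 = 0 *)

Section NilpotentTable.
Variables (R : comPzRingType) (u : R).

(* The canonical deformation of f_n with t = 2 u, which clears denominators,  *)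
(* and with the polynomials expanded at the first weight where they apply.    *)
Definition deformed_coef (i j : nat) : R :=
  match i with
  | 1%N => 1
  | 2%N => match j with
    | 5%N => 1 - 2 * u
    | 6%N => 1 - 4 * u
    | p.+4.+3 => let p := p%:R in
        1 - (6 + 2 * p) * u + (6 + 9 * p + 3 * p ^+ 2) * u ^+ 2
        - (6 + 5 * p + 3 * p ^+ 2 + 4 * p ^+ 3) * u ^+ 3
        + (6 - 39 * p + 58 * p ^+ 2 - 12 * p ^+ 3 + 5 * p ^+ 4) * u ^+ 4
    | _ => 1
    end
  | 3%N => match j with
    | 6%N => 2 * u - 6 * u ^+ 2 + 6 * u ^+ 3 - 6 * u ^+ 4
    | 7%N => 2 * u - 12 * u ^+ 2 + 12 * u ^+ 3 - 12 * u ^+ 4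
    | p.+4.+4 => let p := p%:R in
        2 * u - (18 + 6 * p) * u ^+ 2 + (42 + 42 * p + 12 * p ^+ 2) * u ^+ 3
        - (126 + 148 * p + 54 * p ^+ 2 + 20 * p ^+ 3) * u ^+ 4
    | _ => 2 * u
    end
  | 4%N => match j with
    | p.+4.+3 => let p := p%:R in
        6 * u ^+ 2 - (30 + 24 * p) * u ^+ 3 + (114 + 48 * p + 60 * p ^+ 2) * u ^+ 4
    | _ => 6 * u ^+ 2 - 6 * u ^+ 3 + 6 * u ^+ 4
    end
  | 5%N => match j with
    | p.+4.+4 => 24 * u ^+ 3 - (228 + 120 * p%:R) * u ^+ 4
    | _ => 24 * u ^+ 3 - 108 * u ^+ 4
    end
  | 6%N => 120 * u ^+ 4
  | _ => 0
  end.

Lemma deformed_coef_big i j : (7 <= i)%N -> deformed_coef i j = 0.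
Proof. by case: i => [|[|[|[|[|[|[|i]]]]]]]. Qed.

Lemma alternate_deformed_big i j : (7 <= i)%N -> (7 <= j)%N ->
  alternate deformed_coef i j = 0.
Proof.
by move=> i7 j7; rewrite /alternate; case: ltngtP => ij; rewrite ?deformed_coef_big ?oppr0.
Qed.

Lemma alternate_lt (c : nat -> nat -> R) i j : (i < j)%N -> alternate c i j = c i j.
Proof. by rewrite /alternate => ->. Qed.

Hypothesis u5 : u ^+ 5 = 0.

Lemma deformed_coef_jacobi i j k : (0 < i < j)%N -> (j < k)%N ->
  deformed_coef i j * alternate deformed_coef (i + j) k
  - deformed_coef j k * deformed_coef i (j + k)
  + deformed_coef i k * deformed_coef j (i + k) = 0.
Proof.
move=> ij jk; case: (leqP 7 j) => j7.
  rewrite alternate_deformed_big ?(deformed_coef_big _ j7); try lia.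
  by rewrite mulr0 mul0r subr0 mulr0 addr0.
have [k10|k10] := ltnP k 12.
  move: k10 j7 ij jk.
  by case: i => [|[|[|[|[|[|[|i]]]]]]] //; case: j => [|[|[|[|[|[|[|j]]]]]]] //;
    case: k => [|[|[|[|[|[|[|[|[|[|[|[|k]]]]]]]]]]]] // _ _ _ _; rewrite /alternate /=; ring: u5.
rewrite (alternate_lt _ (_ : i + j < k)%N); last by lia.
have -> : k = (k - 12).+4.+4.+4 by lia.
move: (k - 12)%N j7 ij {jk k10} => p.
by case: i => [|[|[|[|[|[|[|i]]]]]]] //; case: j => [|[|[|[|[|[|[|j]]]]]]] // _ _ /=; ring: u5.
Qed.

End NilpotentTable.

Section Filiform.
Variables (n : nat) (R : comPzRingType).
Hypothesis n5 : (5 <= n)%N.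

Lemma deformed_slice (u : R) : u ^+ 5 = 0 -> is_slice (of_table n (deformed_coef u)).
Proof. by move=> u5; apply: table_slice => // i j k ? ? _; apply: deformed_coef_jacobi. Qed.

(** The factor is 2 + u z with 2 invertible and u nilpotent. Thus d = (- h z u) d, and five
    iterations give d = 0. *)
Lemma deformed_coef_reg (u h d : R) q : u ^+ 5 = 0 -> 2 * h = 1 -> (3 < q)%N ->
  d * (1 + deformed_coef u 2 q + deformed_coef u 3 q) = 0 -> d = 0.
Proof.
move=> u5 h2 q4.
have [z ->] : exists z, 1 + deformed_coef u 2 q + deformed_coef u 3 q = 2 + u * z.
  case: q q4 => [|[|[|[|[|[|[|[|p]]]]]]]] //= _.
  - by exists 2; ring.
  - by exists 0; ring.
  - by exists (- 2 - 6 * u + 6 * u ^+ 2 - 6 * u ^+ 3); ring.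
  - by exists (- 4 - 6 * u + 6 * u ^+ 2 - 6 * u ^+ 3); ring.
  - pose m : R := p%:R; pose m1 : R := p.+1%:R.
    by exists (2 - (6 + 2 * m1) + (6 + 9 * m1 + 3 * m1 ^+ 2 - (18 + 6 * m)) * u
      + (42 + 42 * m + 12 * m ^+ 2 - (6 + 5 * m1 + 3 * m1 ^+ 2 + 4 * m1 ^+ 3)) * u ^+ 2
      + (6 - 39 * m1 + 58 * m1 ^+ 2 - 12 * m1 ^+ 3 + 5 * m1 ^+ 4
         - (126 + 148 * m + 54 * m ^+ 2 + 20 * m ^+ 3)) * u ^+ 3); rewrite /m /m1; ring.
move=> dz; have {}dz : d = (- h * z * u) * d.
  by apply: (eq_of_lincomb2 h (- d) dz h2); ring.
have : forall k, d = (- h * z * u) ^+ k * d.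
  by elim=> [|k IHk]; rewrite ?mul1r // exprSr -mulrA -dz.
by move=> /(_ 5%N) ->; rewrite exprMn u5 mulr0 mul0r.
Qed.

Lemma slice_deformed (y : constants n R) (h : R) : is_slice y -> 2 * h = 1 ->
  coef y 3 4 ^+ 5 = 0 -> y = of_table n (deformed_coef (h * coef y 3 4)).
Proof.
move=> yS h2 t5; set u := h * _.
have u5 : u ^+ 5 = 0 by rewrite exprMn t5 mulr0.
apply: (slice_unique yS (deformed_slice u5)) => [|q d q4 qn].
  case: (leqP 7 n) => n7; last by rewrite !coef_out //; lia.
  by rewrite coef_of_table //= /u mulrA h2 mul1r.
by rewrite !coef_of_table; try lia; exact: (deformed_coef_reg u5 h2 q4).
Qed.

End Filiform.

Section FiliformField.
Variables (K : fieldType) (n : nat).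
Hypothesis n5 : (5 <= n)%N.

Lemma filiformE : filiform K n = of_table n (deformed_coef 0).
Proof.
apply: constants_ext => i j ij ijn; rewrite !coef_of_table //.
case: i ij ijn => [|[|[|[|[|[|[|i]]]]]]] // ij ijn; do ?[by rewrite /=; ring].
- by case: j {ij ijn} => [|[|[|[|[|[|[|j]]]]]]] //=; ring.
- by case: j {ij ijn} => [|[|[|[|[|[|[|[|j]]]]]]]] //=; ring.
- by case: j {ij ijn} => [|[|[|[|[|[|[|j]]]]]]] //=; ring.
- by case: j {ij ijn} => [|[|[|[|[|[|[|[|j]]]]]]]] //=; ring.
Qed.

Lemma filiform_slice : is_slice (filiform K n).
Proof. by rewrite filiformE; apply: deformed_slice; rewrite // expr0n. Qed.

Lemma coef_filiform34 : coef (filiform K n) 3 4 = 0.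
Proof.
case: (leqP 7 n) => n7; last by rewrite coef_out //; lia.
by rewrite coef_of_table.
Qed.

End FiliformField.

(** * The normalized Witt law and the K-points of the slice *)

Section Witt.
Variables (K : fieldType) (K_char0 : [pchar K] =i pred0) (n : nat) (n5 : (5 <= n)%N).

Let natK m : (0 < m)%N -> (m%:R : K) != 0.
Proof. by move/(pcharf0P K).1: K_char0 => -> ; case: m. Qed.

(* The vector e_k of the normalized law is f_k multiplied by this scalar. *)
Definition witt_scale (k : nat) : K := if (k <= 1)%N then 1 else 6 * ((k - 2)`!)%:R.

Definition witt_coef (i j : nat) : K :=
  (j%:R - i%:R) * witt_scale i * witt_scale j / witt_scale (i + j).

Definition normalized_witt : constants n K := of_table n witt_coef.

Lemma witt_scale_neq0 k : witt_scale k != 0.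
Proof.
by rewrite /witt_scale; case: ifP => _; rewrite ?oner_neq0 // mulf_neq0 ?natK ?fact_gt0.
Qed.

(** This recursion expresses X_1k = 1. The initial value 6 is forced by X_23 = 1: with c_k the scale
    of f_k, it means c_2 c_3 = c_5, where c_3 = c_2 and c_5 = 6 c_2. *)
Lemma witt_scaleS k : (1 < k)%N -> witt_scale k.+1 = (k%:R - 1) * witt_scale k.
Proof.
case: k => [|[|k]] // _; rewrite /witt_scale /= !subSS !subn0 factS natrM.
by rewrite -!natr1; ring.
Qed.

Lemma witt_scale2 : witt_scale 2 = 6. Proof. exact: mulr1. Qed.
Lemma witt_scale3 : witt_scale 3 = 6. Proof. exact: mulr1. Qed.

Lemma witt_scale4 : witt_scale 4 = 12.
Proof. by rewrite (@witt_scaleS 3) // witt_scale3; ring. Qed.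
Lemma witt_scale5 : witt_scale 5 = 36.
Proof. by rewrite (@witt_scaleS 4) // witt_scale4; ring. Qed.
Lemma witt_scale7 : witt_scale 7 = 720.
Proof. by rewrite (@witt_scaleS 6) // (@witt_scaleS 5) // witt_scale5; ring. Qed.

Lemma alternate_witt i j : alternate witt_coef i j = witt_coef i j.
Proof.
rewrite /alternate /witt_coef; case: ltngtP => // [_|->]; last by rewrite subrr !mul0r.
by rewrite addnC -!mulNr opprB (mulrAC (_ - _)).
Qed.

Lemma normalized_witt_slice : is_slice normalized_witt.
Proof.
have c1 : witt_scale 1 = 1 by [].
apply: table_slice => // [k k1||i j k ij jk _].
- rewrite /witt_coef c1 add1n witt_scaleS // mulr1 divff // mulf_neq0 ?witt_scale_neq0 //.
  by rewrite -(natrB _ (ltnW k1)) natK // subn_gt0.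
- rewrite /witt_coef witt_scale2 witt_scale3 witt_scale5.
  have n36 : (36 : K) != 0 by rewrite natK.
  by field.
rewrite alternate_witt /witt_coef.
have -> : (j + (i + k) = i + j + k)%N by lia.
have -> : (i + (j + k) = i + j + k)%N by lia.
have := witt_scale_neq0 (i + j); have := witt_scale_neq0 (j + k).
have := witt_scale_neq0 (i + k); have := witt_scale_neq0 (i + j + k).
move: (witt_scale (i + j)) (witt_scale (j + k)) (witt_scale (i + k)) (witt_scale (_ + k)).
move=> cij cjk cik cijk n1 n2 n3 n4; rewrite !natrD.
by field; rewrite ?n1 ?n2 ?n3 ?n4.
Qed.

Lemma coef_normalized_witt34 : (7 <= n)%N -> coef normalized_witt 3 4 = 1 / 10.
Proof.
move=> n7; rewrite coef_of_table // /witt_coef witt_scale3 witt_scale4 witt_scale7.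
have n10 : (10 : K) != 0 by rewrite natK.
have n720 : (720 : K) != 0 by rewrite natK.
by field; rewrite ?n10 ?n720.
Qed.

(** With q = p + 4, the sum is a quotient of two positive integers, hence nonzero in characteristic
    0. *)
Lemma normalized_witt_reg q : (3 < q)%N -> (q + 5 <= n)%N ->
  1 + coef normalized_witt 2 q + coef normalized_witt 3 q != 0.
Proof.
move=> q4 qn; rewrite !coef_of_table ?q4 ?(ltnW q4) //; try lia.
have -> : q = (q - 4).+4 by lia.
move: (q - 4)%N => p {q q4 qn}; rewrite /witt_coef.
rewrite add2n add3n witt_scale2 witt_scale3.
rewrite (@witt_scaleS p.+4.+2) // (@witt_scaleS p.+4.+1) // (@witt_scaleS p.+4) //.
have c0 := witt_scale_neq0 p.+4; set c := witt_scale _ in c0 *.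
have [p3 p4 p5] : [/\ p%:R + 3 != 0 :> K, p%:R + 4 != 0 :> K & p%:R + 5 != 0 :> K].
  by rewrite -!natrD !natK // addn_gt0 orbT.
rewrite (_ : _ + _ = ((p + 5) * (p + 4) * (p + 3) + 6 * (p + 2) * (p + 5) + 6 * (p + 1))%:R
  / ((p%:R + 5) * (p%:R + 4) * (p%:R + 3))).
  by rewrite mulf_neq0 ?invr_eq0 ?mulf_neq0 // natK // addnC addn_gt0 muln_gt0 addn_gt0 orbT.
have -> : p.+4%:R = p%:R + 4 :> K by rewrite -natrD; congr _%:R; lia.
have -> : p.+4.+1%:R = p%:R + 5 :> K by rewrite -natrD; congr _%:R; lia.
have -> : p.+4.+2%:R = p%:R + 6 :> K by rewrite -natrD; congr _%:R; lia.
rewrite !(natrD, natrM).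
have [e3 e4 e5] : [/\ p%:R + 4 - 1 = p%:R + 3 :> K, p%:R + 5 - 1 = p%:R + 4 :> K
                    & p%:R + 6 - 1 = p%:R + 5 :> K] by split; ring.
by rewrite e3 e4 e5; field; rewrite c0 p3 p4 p5.
Qed.

Lemma slice_field34 (y : constants n K) : (12 <= n)%N -> is_slice y ->
  coef y 3 4 = 0 \/ coef y 3 4 = 1 / 10.
Proof.
move=> n12 yS; have /eqP := slice_weight12 yS n12.
rewrite 2!mulf_eq0 (negPf (natK (isT : 0 < 36)%N)) /= expf_eq0 /=.
case/orP => [/eqP ->|]; first by left.
rewrite subr_eq0 => /eqP E; right.
by apply: (canRL (mulfK (natK (isT : 0 < 10)%N))); rewrite mulrC.
Qed.

Lemma slice_fieldP (y : constants n K) : (12 <= n)%N ->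
  is_slice y <-> y = filiform K n \/ y = normalized_witt.
Proof.
move=> n12; split=> [yS|[->|->]]; [|exact: filiform_slice|exact: normalized_witt_slice].
have h2 : 2 * 2^-1 = 1 :> K by rewrite divff // natK.
case: (slice_field34 n12 yS) => y34; [left|right].
  by rewrite filiformE // (slice_deformed n5 yS h2) y34 ?mulr0 ?expr0n.
apply: (slice_unique yS normalized_witt_slice) => [|q d q4 qn /eqP].
  by rewrite y34 coef_normalized_witt34 //; lia.
by rewrite mulf_eq0 (negPf (normalized_witt_reg q4 qn)) orbF => /eqP.
Qed.

Lemma small_slice_unique (y : constants n K) : (n <= 6)%N -> is_slice y <-> y = filiform K n.
Proof.
move=> n6; split=> [yS|->]; last exact: filiform_slice.
apply: (slice_unique yS (@filiform_slice K n n5)) => [|q d q4 qn]; last by lia.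
by rewrite !coef_out //; lia.
Qed.

End Witt.

(** * Isomorphisms, and the separation of f_n from the Witt algebra *)

Section Bracket.
Variables (n : nat) (R : comPzRingType).
Implicit Types x y : constants n R.

Lemma intertwines_diag x y (gamma : nat -> R) :
    (forall i j, (0 < i < j)%N -> (i + j <= n)%N ->
       coef x i j * gamma (i + j)%N = gamma i * gamma j * coef y i j) ->
  intertwines x y (diag_mx (\row_(i < n) gamma i.+1)).
Proof.
move=> xy; have {}xy i j : (0 < i)%N -> (0 < j)%N -> (i + j <= n)%N ->
    coef x i j * gamma (i + j)%N = gamma i * gamma j * coef y i j.
  move=> i0 j0 ijn; have [ij|ji|->] := ltngtP i j; first by apply: xy; rewrite ?i0.
    by rewrite coef_swap addnC mulNr xy ?j0 // 1?addnC // (coef_swap y); ring.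
  by rewrite !coef_diag mulr0 mul0r.
move=> u v; apply/rowP => k; rewrite mul_mx_diag !mxE mulr_suml; apply: eq_bigr => i _.
rewrite mulr_suml; apply: eq_bigr => j /eqP ijk; rewrite !mul_mx_diag !mxE.
rewrite -mulrA -ijk xy //; last by rewrite ijk.
by ring.
Qed.

Lemma bracket_delta x (a b : 'I_n) (c d : R) :
  bracket x (c *: delta_mx 0 a) (d *: delta_mx 0 b) =
  \row_k (if (a.+1 + b.+1 == k.+1)%N then c * d * coef x a.+1 b.+1 else 0).
Proof.
apply/rowP => k; rewrite !mxE (bigD1 a) //= [X in _ + X]big1 ?addr0; last first.
  by move=> i /negPf ia; rewrite big1 // => j _; rewrite !mxE ia andbF mulr0 !mul0r.
case: ifP => abk; last first.
  rewrite big1 // => j ajk; rewrite !mxE (eqxx 0) /=.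
  case: (j =P b) => [jb|]; last by rewrite !(mulr0, mul0r).
  by rewrite jb abk in ajk.
rewrite (bigD1 b) //= [X in _ + X]big1 ?addr0; last first.
  by move=> j /andP[_ /negPf jb]; rewrite !mxE jb andbF !mulr0 mul0r.
by rewrite !mxE !eqxx !mulr1.
Qed.

End Bracket.

Section Isomorphism.
Variables (K : fieldType) (n : nat).

Lemma bracket_low (x : constants n K) u v (k : 'I_n) : (k < 2)%N -> bracket x u v 0 k = 0.
Proof.
move=> k2; rewrite mxE big1 // => i _; rewrite big1 // => j /eqP ijk.
have [-> ->] : nat_of_ord i = 0%N /\ nat_of_ord j = 0%N by lia.
by rewrite coef_diag mulr0.
Qed.

(** Brackets have no component on e_1 and e_2, while f_n has X_ij = 0 for 3 <= i < j: its derived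
    algebra is abelian. *)
Lemma filiform_metabelian (u v u' v' : 'rV[K]_n) (x := filiform K n) :
  bracket x (bracket x u v) (bracket x u' v') = 0.
Proof.
apply/rowP => k; rewrite !mxE big1 // => i _; rewrite big1 // => j /eqP ijk.
case: (ltnP i 2) => i2; first by rewrite bracket_low // !mul0r.
case: (ltnP j 2) => j2; first by rewrite (bracket_low _ _ _ j2) mulr0 mul0r.
rewrite coef_of_table_alternate // ?ijk // /alternate.
have -> : (i.+1 <= 2)%N = false by lia.
have -> : (j.+1 <= 2)%N = false by lia.
by rewrite oppr0 !if_same mulr0.
Qed.

Lemma isomorphic_metabelian (x y : constants n K) : isomorphic x y ->
    (forall u v u' v', bracket x (bracket x u v) (bracket x u' v') = 0) ->
  forall u v u' v', bracket y (bracket y u v) (bracket y u' v') = 0.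
Proof.
case=> g gU xy xM u v u' v'.
have E (w : 'rV[K]_n) : w = w *m invmx g *m g by rewrite mulmxKV.
by rewrite (E u) (E v) (E u') (E v') -!xy xM mul0mx.
Qed.

Hypothesis K_char0 : [pchar K] =i pred0.

(** In the Witt algebra [[f_1, f_2], [f_1, f_3]] = [f_3, 2 f_4] = 2 f_7, which is nonzero once n >=
    7, so the derived algebra is not abelian. *)
Lemma filiform_not_isomorphic_witt : (7 <= n)%N -> ~ isomorphic (filiform K n) (witt K n).
Proof.
move=> n7 /isomorphic_metabelian/(_ filiform_metabelian).
have lt_n k : (k < 7)%N -> (k < n)%N by move=> k7; apply: leq_trans n7.
pose f k (k7 : (k < 7)%N) : 'rV[K]_n := 1 *: delta_mx 0 (Ordinal (lt_n k k7)).
have E a b c (a7 : (a < 7)%N) (b7 : (b < 7)%N) (c7 : (c < 7)%N) :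
    (a < b)%N -> (a.+1 + b.+1 = c.+1)%N ->
    bracket (witt K n) (f a a7) (f b b7) =
    (b%:R - a%:R) *: delta_mx 0 (Ordinal (lt_n c c7)).
  move=> ab abc; rewrite bracket_delta coef_of_table /=; [|lia|lia].
  apply/rowP => k; rewrite !mxE eqxx /= !mul1r abc eqSS -val_eqE /= eq_sym.
  by case: eqP; rewrite ?mulr1 ?mulr0 // -!natr1 opprD addrACA subrr addr0.
move=> /(_ (f 0%N isT) (f 1%N isT) (f 0%N isT) (f 2%N isT)).
rewrite (E 0%N 1%N 2%N) // (E 0%N 2%N 3%N) // bracket_delta.
move/rowP/(_ (Ordinal (lt_n 6 isT)))/eqP; rewrite !mxE /= coef_of_table //.
rewrite -!natrB // !mulf_eq0 !((pcharf0P K).1 K_char0) //.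
Qed.

Lemma normalized_witt_isomorphic : isomorphic (normalized_witt K n) (witt K n).
Proof.
exists (diag_mx (\row_(i < n) witt_scale K i.+1)).
  rewrite unitmxE det_diag unitfE; apply/prodf_neq0 => i _.
  by rewrite mxE witt_scale_neq0.
apply: intertwines_diag => i j ij ijn; rewrite !coef_of_table //.
by rewrite /witt_coef mulfVK ?witt_scale_neq0 //; ring.
Qed.

Lemma witt_lawP : (12 <= n)%N ->
  is_witt_law (normalized_witt K n) /\ forall y, is_witt_law y -> y = normalized_witt K n.
Proof.
move=> n12; have n5 : (5 <= n)%N by lia.
split; first by split; [exact: normalized_witt_slice|exact: normalized_witt_isomorphic].
move=> y [/(slice_fieldP K_char0 n5 _ n12)[->|//] /filiform_not_isomorphic_witt[]].
by lia.
Qed.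

End Isomorphism.

(** * Inverses and reducedness in K[[s]] *)

Section PowerSeriesField.
Variable K : fieldType.
Implicit Types f g : fps K.

Lemma fps_mulrE f g k : (f * g) k = \sum_(i < k.+1) f i * g (k - i)%N.
Proof. by []. Qed.

Lemma fps_0E k : (0 : fps K) k = 0.
Proof. exact: if_same. Qed.

Lemma fps_1E k : (1 : fps K) k = (k == 0%N)%:R.
Proof. by change (@fpsC K 1 k = (k == 0%N)%:R); rewrite /fpsC; case: eqP. Qed.

Lemma fps_mul0E f g : (f * g) 0%N = f 0%N * g 0%N.
Proof. by rewrite fps_mulrE big_ord1. Qed.

Fact fpsC_zmod_morphism : zmod_morphism (@fpsC K).
Proof.
move=> a b; apply/funext => k; change (fpsC (a - b) k = fpsC a k - fpsC b k).
by rewrite /fpsC; case: ifP => _; rewrite ?subr0.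
Qed.

Fact fpsC_monoid_morphism : monoid_morphism (@fpsC K).
Proof.
split=> // a b; apply/funext => k; rewrite fps_mulrE big_ord_recl subn0 big1 ?addr0.
  by rewrite /fpsC; case: eqP; rewrite ?mulr0.
by move=> i _; rewrite mul0r.
Qed.

HB.instance Definition _ := GRing.isZmodMorphism.Build K (fps K) (@fpsC K) fpsC_zmod_morphism.
HB.instance Definition _ := GRing.isMonoidMorphism.Build K (fps K) (@fpsC K) fpsC_monoid_morphism.

(** The list of the first [k] coefficients of the inverse: each new one is solved from the Cauchy
    product and needs all the earlier ones, hence the recursion on lists. *)
Fixpoint fps_inv_coefs f (k : nat) : seq K :=
  if k is k'.+1 then
    let s := fps_inv_coefs f k' in
    rcons s (((k' == 0%N)%:R - \sum_(i < k') f i.+1 * s`_(k' - i.+1)) / f 0%N)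
  else [::].

Definition fps_inv f : fps K := fun k => (fps_inv_coefs f k.+1)`_k.

Lemma size_fps_inv_coefs f k : size (fps_inv_coefs f k) = k.
Proof. by elim: k => //= k IHk; rewrite size_rcons IHk. Qed.

Lemma nth_fps_inv_coefs f k i : (i < k)%N -> (fps_inv_coefs f k)`_i = fps_inv f i.
Proof.
elim: k => // k IHk; rewrite ltnS leq_eqVlt => /orP[/eqP -> //|ik].
by rewrite /= nth_rcons size_fps_inv_coefs ik IHk.
Qed.

Lemma fps_mulV f : f 0%N != 0 -> f * fps_inv f = 1.
Proof.
move=> f0; apply/funext => k; rewrite fps_mulrE big_ord_recl subn0 /=.
rewrite {1}/fps_inv /= nth_rcons size_fps_inv_coefs ltnn eqxx.
rewrite mulrC divfK //; rewrite (eq_bigr (fun i : 'I_k => f i.+1 * fps_inv f (k - i.+1)%N)).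
  by rewrite subrK fps_1E.
by move=> i _; rewrite nth_fps_inv_coefs ?subSS //; case: i => i /= ik; lia.
Qed.

Lemma fps_inv0 f : f 0%N = 1 -> fps_inv f 0%N = 1.
Proof.
move=> f0; have := fps_mulV (_ : f 0%N != 0); rewrite f0 oner_neq0 => /(_ isT).
by move/(congr1 (@^~ 0%N)); rewrite fps_mul0E f0 mul1r.
Qed.

(** If the coefficients of g below m vanish, the coefficient of index 2m in g^2 is the square of the
    m-th one, so g^2 = 0 gives g = 0. Raising the exponent to a power of 2 reduces the claim to
    squares. *)
Lemma fps_reduced f k : f ^+ k = 0 -> f = 0.
Proof.
have sq g : g * g = 0 -> g = 0.
  move=> g2; apply/funext; elim/ltn_ind => m IH.
  have : (g * g) (m + m)%N = 0 by rewrite g2 fps_0E.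
  rewrite fps_mulrE (bigD1 (Ordinal (leq_addr m m.+1))) //= addnK big1 ?addr0.
    by move=> /eqP; rewrite mulf_eq0 orbb fps_0E => /eqP.
  move=> i im; have {}im : i != m :> nat by [].
  have [ilt|] := ltnP i m; first by rewrite IH // fps_0E mul0r.
  by move=> kle; rewrite (IH (m + m - i)%N) ?fps_0E ?mulr0 //; have := ltn_ord i; lia.
move=> fk; have : f ^+ (2 ^ k) = 0.
  by rewrite -(subnK (ltnW (ltn_expl k (isT : 1 < 2)%N))) exprD fk mulr0.
elim: k {fk} => [|k IHk] //; rewrite expnS mul2n -addnn exprD => /sq; exact: IHk.
Qed.

End PowerSeriesField.

(** * Rigidity by diagonal normalization of K[[s]]-points *)

Section Rigidity.
Variables (K : fieldType) (n : nat).
Hypothesis n5 : (5 <= n)%N.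

Section Normalization.
Variable X : constants n (fps K).

(* Images of the basis vectors under the diagonal change of basis with *)
(* gamma_1 = 1 which turns X_1k and X_23 into 1.                        *)
Fixpoint normalizer (k : nat) : fps K :=
  match k with
  | 0 | 1%N => 1
  | 2%N => coef X 2 3 * fps_inv (coef X 1 3) * fps_inv (coef X 1 4)
  | k'.+1 => normalizer k' * fps_inv (coef X 1 k')
  end.

Definition normalized : constants n (fps K) :=
  of_table n (fun i j => coef X i j * normalizer (i + j)%N
                         * fps_inv (normalizer i) * fps_inv (normalizer j)).

Hypothesis XL : is_law X.
Hypothesis X23 : coef X 2 3 0%N = 1.
Hypothesis X1k : forall k, (1 < k < n)%N -> coef X 1 k 0%N = 1.

Lemma normalizerS k : (1 < k)%N -> normalizer k.+1 = normalizer k * fps_inv (coef X 1 k).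
Proof. by case: k => [|[|k]]. Qed.

Lemma normalizer0 k : (k <= n)%N -> normalizer k 0%N = 1.
Proof.
have i1 j : (1 < j < n)%N -> fps_inv (coef X 1 j) 0%N = 1 by move=> jn; rewrite fps_inv0 ?X1k.
elim: k => [|k IHk] kn; first by rewrite /= fps_1E.
case: (ltnP 1 k) => [k1|]; first by rewrite normalizerS // fps_mul0E IHk ?(ltnW kn) // mul1r i1 ?k1.
case: k {IHk kn} => [|[|//]] _; first by rewrite /= fps_1E.
by rewrite /= !fps_mul0E X23 !i1 ?mulr1 //; lia.
Qed.

Lemma normalizerK k : (k <= n)%N -> normalizer k * fps_inv (normalizer k) = 1.
Proof. by move=> kn; rewrite fps_mulV // normalizer0 // oner_neq0. Qed.

Lemma coef_normalized i j : (0 < i)%N -> (0 < j)%N -> (i + j <= n)%N ->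
  coef normalized i j = coef X i j * normalizer (i + j)%N
                        * fps_inv (normalizer i) * fps_inv (normalizer j).
Proof.
move=> i0 j0 ijn; rewrite coef_of_table_alternate // /alternate.
case: ltngtP => [//|_|->]; last by rewrite coef_diag !mul0r.
by rewrite (coef_swap X) addnC !mulNr opprK -!mulrA [X in _ * (_ * X)]mulrC.
Qed.

Lemma normalized_intertwines :
  intertwines X normalized (diag_mx (\row_(i < n) normalizer i.+1)).
Proof.
apply: intertwines_diag => i j ij ijn; rewrite coef_normalized; try lia.
have [iK jK] : normalizer i * fps_inv (normalizer i) = 1 /\
    normalizer j * fps_inv (normalizer j) = 1 by split; apply: normalizerK; lia.
rewrite -[LHS]mulr1 -[X in _ * X]mulr1 -{1}iK -{1}jK; ring.
Qed.

Lemma normalized_slice : is_slice normalized.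
Proof.
have X1V k : (1 < k < n)%N -> coef X 1 k * fps_inv (coef X 1 k) = 1.
  by move=> kn; rewrite fps_mulV // X1k // oner_neq0.
have g1 : normalizer 1 = 1 by [].
have i1 : fps_inv (1 : fps K) = 1.
  by have := normalizerK (ltnW (leq_trans (isT : 1 < 5)%N n5)); rewrite g1 mul1r.
apply/isSliceP; split=> [i j k ij jk ijk||k kn].
(* All three Jacobi terms are multiplied by one factor, symmetric in the indices, so the identity
   survives the change of basis. *)
- have term a b c : (0 < a)%N -> (0 < b)%N -> (0 < c)%N -> (a + b + c <= n)%N ->
      coef normalized a b * coef normalized (a + b) c = coef X a b * coef X (a + b) c *
        (normalizer (a + b + c) * fps_inv (normalizer a) * fps_inv (normalizer b)
         * fps_inv (normalizer c)).
    move=> a0 b0 c0 abc; rewrite !coef_normalized ?addn_gt0 ?a0 //; last by lia.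
    rewrite -[RHS]mulr1 -(normalizerK (_ : a + b <= n)%N); last by lia.
    by ring.
  have XJ := (isLawP X).1 XL i j k ij jk ijk; rewrite /jacobi in XJ.
  rewrite /jacobi !term; try lia.
  have -> : (j + k + i = i + j + k)%N by lia.
  have -> : (k + i + j = i + j + k)%N by lia.
  set c := normalizer _ * _ * _ * _ in XJ *.
  by apply: (eq_of_lincomb c XJ); rewrite /c; ring.
(* Writing g_k for [normalizer k], X_23 becomes 1 when X_23 g_5 = g_2 g_3. As g_5 = g_3 / (X_13
   X_14), this forces g_2 = X_23 / (X_13 X_14), the value in the definition. *)
- rewrite coef_normalized // (@normalizerS 4) // (@normalizerS 3) //.
  have K3 := normalizerK (_ : 3 <= n)%N; have {}K3 := K3 ltac:(lia).
  have K2 := normalizerK (_ : 2 <= n)%N; have {}K2 := K2 ltac:(lia).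
  have g2 : normalizer 2 = coef X 2 3 * fps_inv (coef X 1 3) * fps_inv (coef X 1 4) by [].
  rewrite -[RHS]mulr1 -{1}K2 -K3; move: (normalizer 3) (normalizer 2) g2 => g3 c E.
  by apply: (eq_of_lincomb (- (g3 * fps_inv c * fps_inv g3)) E); ring.
- rewrite coef_normalized; try lia.
  rewrite g1 i1 add1n normalizerS; last by lia.
  have Kk := normalizerK (_ : k <= n)%N; have {}Kk := Kk ltac:(lia).
  move: (normalizer k) Kk (fps_inv (coef X 1 k)) (X1V k kn) => c Kk d Xd.
  rewrite (_ : _ * _ = coef X 1 k * d * (c * fps_inv c)); first by rewrite Xd Kk mulr1.
  by ring.
Qed.

End Normalization.

(* A K[[s]]-law reducing to a point of the slice is moved into the slice by a  *)
(* diagonal matrix congruent to 1, so only K[[s]]-points of the slice matter.  *)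
Lemma rigid_of_slice (x : constants n K) : is_slice x ->
    (forall y : constants n (fps K), is_slice y -> (forall p, y p 0%N = x p) ->
       y = [ffun p => fpsC (x p)]) ->
  rigid x.
Proof.
move=> xS xU X XL X0.
have coef0 i j : coef X i j 0%N = coef x i j.
  rewrite /coef; case: insubP => [p _ _|_]; first exact: X0.
  by case: insubP => [p _ _|_]; rewrite ?fps_0E // -X0.
have [_ x23 x1k] := (isSliceP x).1 xS.
have X23 : coef X 2 3 0%N = 1 by rewrite coef0.
have X1k k : (1 < k < n)%N -> coef X 1 k 0%N = 1 by move=> kn; rewrite coef0 x1k.
exists (diag_mx (\row_(i < n) normalizer X i.+1)); split.
- apply/matrixP => i j; rewrite !mxE; case: (i =P j) => [_|_]; last exact: fps_0E.
  by rewrite mulr1n (normalizer0 X23 X1k (ltn_ord i)).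
- by move=> z _; exact: diag_mxC.
suff <- : normalized X = [ffun p => fpsC (x p)] by exact: normalized_intertwines.
apply: xU; first exact: normalized_slice.
move=> -[[i j] ijP]; have ijn := ijP; rewrite mem_pair_index in ijn.
have inv0 k : (k <= n)%N -> fps_inv (normalizer X k) 0%N = 1.
  by move=> kn; rewrite fps_inv0 // normalizer0.
rewrite -!(coef_seq_sub _ ijP) coef_normalized; try lia.
by rewrite !fps_mul0E coef0 normalizer0 ?inv0 ?mulr1 //; lia.
Qed.

End Rigidity.

Section RigidPoints.
Variables (K : fieldType) (n : nat) (n5 : (5 <= n)%N).

Lemma fps_mulfI (f g : fps K) : f 0%N != 0 -> f * g = 0 -> g = 0.
Proof. by move=> f0 fg; rewrite -[g]mul1r -(fps_mulV f0) mulrAC fg mul0r. Qed.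

(** A series with nonzero constant term is invertible, so the uniqueness lemma applies to the
    constant point over K[[s]]; rigidity is reduced to t being constant. *)
Lemma rigid_of_coef34 (x : constants n K) : is_slice x ->
    (forall q, (3 < q)%N -> (q + 5 <= n)%N -> 1 + coef x 2 q + coef x 3 q != 0) ->
    (forall y : constants n (fps K), is_slice y -> coef y 3 4 0%N = coef x 3 4 ->
       coef y 3 4 = fpsC (coef x 3 4)) ->
  rigid x.
Proof.
move=> xS xreg x34; apply: rigid_of_slice => // y yS y0.
apply: (slice_unique yS (is_slice_rmorph (@fpsC K) xS)) => [|q d q4 qn].
  rewrite coef_rmorph; apply: x34 => //; rewrite /coef.
  by case: insubP => [p _ _|_]; rewrite ?y0 //; case: insubP => [p _ _|_]; rewrite ?fps_0E // -y0.
rewrite !coef_rmorph -[1](rmorph1 (@fpsC K)) -!rmorphD mulrC.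
by apply: fps_mulfI; exact: xreg.
Qed.

Lemma fps_nat0 m : (m%:R : fps K) 0%N = m%:R.
Proof. by rewrite -(rmorph_nat (@fpsC K)). Qed.

Lemma rigid_filiform_small : (n <= 6)%N -> rigid (filiform K n).
Proof.
move=> n6; apply: rigid_of_coef34 => [|q q4 qn|y _ _]; [exact: filiform_slice|lia|].
by rewrite !coef_out ?rmorph0 //; lia.
Qed.

Hypothesis K_char0 : [pchar K] =i pred0.

Let natK m : (0 < m)%N -> (m%:R : K) != 0.
Proof. by move/(pcharf0P K).1: K_char0 => -> ; case: m. Qed.

(** In the weight 12 equation, 10 t - 1 has constant term -1 and can be cancelled. What remains is
    t^5 = 0, hence t = 0 in K[[s]]. *)
Lemma rigid_filiform : (12 <= n)%N -> rigid (filiform K n).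
Proof.
move=> n12; apply: rigid_of_coef34 => [|q q4 qn|y yS].
- exact: filiform_slice.
- by rewrite !coef_of_table ?q4 ?(ltnW q4) //=; [rewrite addr0; exact: (@natK 2)|lia|lia].
rewrite (@coef_filiform34 K n n5) => y0; have := slice_weight12 yS n12.
rewrite mulrC => /fps_mulfI E; rewrite rmorph0; apply: (@fps_reduced _ _ 5).
apply: (@fps_mulfI 36); first by rewrite fps_nat0 natK.
apply: E; change (((10 : fps K) * coef y 3 4) 0%N - (1 : fps K) 0%N != 0).
by rewrite fps_mul0E y0 mulr0 fps_1E sub0r oppr_eq0 oner_neq0.
Qed.

Lemma rigid_normalized_witt : (12 <= n)%N -> rigid (normalized_witt K n).
Proof.
move=> n12; have n7 : (7 <= n)%N by lia.
apply: rigid_of_coef34 => [|q q4 qn|y yS].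
- exact: normalized_witt_slice.
- exact: normalized_witt_reg.
rewrite coef_normalized_witt34 // => y0; have := slice_weight12 yS n12.
have n10 : (10 : K) != 0 by rewrite natK.
have yn0 : coef y 3 4 0%N != 0 by rewrite y0 mulf_neq0 ?oner_neq0 ?invr_eq0.
(* Near the Witt law the other factor of weight 12 is the invertible one: 36 t^5 has a nonzero
   constant term. *)
move=> /fps_mulfI E; have {}E : 10 * coef y 3 4 - 1 = 0.
  apply: E; rewrite fps_mul0E fps_nat0 mulf_neq0 ?natK //.
  by elim: (5%N) => [|k IHk]; rewrite ?fps_1E ?oner_neq0 // exprS fps_mul0E mulf_neq0.
apply/eqP; rewrite -subr_eq0; apply/eqP; apply: (@fps_mulfI 10); first by rewrite fps_nat0.
apply: (eq_of_lincomb 1 E).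
rewrite -[10](rmorph_nat (@fpsC K)).
have : fpsC (10 * (1 / 10)) = 1 :> fps K by rewrite mul1r divff // rmorph1.
by rewrite rmorphM => F; apply: (eq_of_lincomb (-1) F); ring.
Qed.

End RigidPoints.

(** * Morphisms to and from localizations *)

Lemma slice_rels_rmorph n (R S : comPzRingType) (f : {rmorphism R -> S}) (x : constants n R) :
  slice_rels [ffun p => f (x p)] = [seq f r | r <- slice_rels x].
Proof.
rewrite /slice_rels map_cat -!map_comp; congr (_ ++ _).
  by apply: eq_map => t /=; rewrite jacobi_rmorph.
by apply: eq_map => p /=; rewrite coef_rmorph rmorphB rmorph1.
Qed.

Section LocalizationMorphisms.
Variables (K : comNzRingType) (R : comAlgType K) (S : mulrClosed R) (gens : seq R).
Notation L := (localization S gens).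
Notation to_L := (to_loc S gens).

Fact to_loc_zmod_morphism : zmod_morphism to_L.
Proof.
move=> a b; rewrite /to_loc; change (Defs.frac gens (a - b) (den1 S) =
  loc_add (Defs.frac gens a (den1 S)) (loc_opp (Defs.frac gens b (den1 S)))).
by rewrite oppE addE; apply: frac_eq; rewrite /= !mulr1.
Qed.

Fact to_loc_monoid_morphism : monoid_morphism to_L.
Proof.
split=> // a b; change (to_L (a * b) = loc_mul (to_L a) (to_L b)).
by rewrite /to_loc mulE; apply: frac_eq; rewrite /= !mulr1.
Qed.

HB.instance Definition _ := GRing.isZmodMorphism.Build R L to_L to_loc_zmod_morphism.
HB.instance Definition _ := GRing.isMonoidMorphism.Build R L to_L to_loc_monoid_morphism.

Lemma loc_scaleE c (z : L) : c *: z = to_L c%:A * z.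
Proof.
case: (fracP z) => -[a d] ->.
change (loc_scale c (Defs.frac gens a d) = loc_mul (to_L c%:A) (Defs.frac gens a d)).
by rewrite /to_loc scaleE mulE; apply: frac_eq; rewrite /= mul1r mulr_algl.
Qed.

Lemma to_loc_alg c : to_L c%:A = c *: (1 : L) :> L.
Proof. by rewrite loc_scaleE mulr1. Qed.

Lemma frac_to_loc a d : Defs.frac gens a d * to_L (val d) = to_L a.
Proof.
change (loc_mul (Defs.frac gens a d) (to_L (val d)) = to_L a).
by rewrite /to_loc mulE; apply: frac_eq; rewrite /= !mulr1.
Qed.

Lemma to_loc_unit d : d \in S -> exists e : L, to_L d * e = 1.
Proof.
move=> dS; exists (Defs.frac gens 1 (exist _ d dS)).
by rewrite mulrC (frac_to_loc 1 (exist _ d dS)) rmorph1.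
Qed.

Lemma to_loc_gens r : r \in gens -> to_L r = 0.
Proof.
move=> /(nthP 0)[i ig <-]; apply/eqP/frac_eqP; exists 1; first exact: rpred1.
exists [ffun k => (k == Ordinal ig)%:R]; rewrite (bigD1 (Ordinal ig)) //= big1.
  by rewrite ffunE eqxx !mul1r mulr1 mul0r subr0 addr0.
by move=> k /negPf ki; rewrite ffunE ki mul0r.
Qed.

(** Gives lower bounds on the localization: a morphism killing the generators tests whether a germ
    is zero, even if it does not invert [S]. The price is the factor [f u]. *)
Lemma to_loc_eq0 (B : comPzRingType) (f : {rmorphism R -> B}) a :
    (forall r, r \in gens -> f r = 0) -> to_L a = 0 ->
  exists2 u, u \in S & f u * f a = 0.
Proof.
move=> f0 /eqP/frac_eqP[u uS [c /= E]]; exists u => //; rewrite -rmorphM.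
have -> : u * a = \sum_i c i * gens`_i by rewrite -E mulr1 mul0r subr0.
rewrite rmorph_sum big1 // => i _; rewrite rmorphM (f0 gens`_i) ?mulr0 //.
by rewrite mem_nth.
Qed.

End LocalizationMorphisms.

Lemma rmorph_mpoly_ext m (K : comNzRingType) (A : comPzRingType)
    (f g : {rmorphism {mpoly K[m]} -> A}) :
    (forall c, f c%:A = g c%:A) -> (forall i, f 'X_i = g 'X_i) ->
  f =1 g.
Proof.
move=> fgC fgX p; rewrite (mpolyE p) !rmorph_sum; apply: eq_bigr => mn _.
rewrite -mulr_algl !rmorphM fgC mpolyXE_id !rmorph_prod; congr (_ * _).
by apply: eq_bigr => i _; rewrite !rmorphXn fgX.
Qed.

(** * The tautological point of a localized coordinate ring *)

Section SliceLocalization.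
Variables (K : fieldType) (n : nat).
Notation pol := {mpoly K[#|{: pair_index n}|]}.
Notation gens := (slice_rels (generic K n)).

Lemma eval_generic (x : constants n K) p : eval_at x (generic K n p) = x p.
Proof. by rewrite ffunE /eval_at mevalXU enum_rankK. Qed.

Lemma rmorph_gens (B : comPzRingType) (f : {rmorphism pol -> B}) (z : constants n B) :
    is_slice z -> (forall p, f (generic K n p) = z p) ->
  forall r, r \in gens -> f r = 0.
Proof.
move=> zS fz r rg; apply: zS.
have E : [ffun p => f (generic K n p)] = z by apply/ffunP => p; rewrite ffunE.
have : f r \in slice_rels [ffun p => f (generic K n p)].
  by rewrite slice_rels_rmorph; exact: map_f.
by rewrite E.
Qed.

Lemma eval_gens (x : constants n K) r : is_slice x -> r \in gens -> eval_at x r = 0.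
Proof.
pose ev : {rmorphism pol -> K} := meval (fun k => x (enum_val k)).
by move=> xS; apply: (rmorph_gens (f := ev) xS); exact: eval_generic.
Qed.

Variable S : mulrClosed pol.
Notation L := (localization S gens).
Notation to_L := (to_loc S gens).

(** For [S = nonvanishing x] this is the canonical deformation of [x]; a general [S] also covers the
    coordinate ring. *)
Definition tautological_point : constants n L := [ffun p => to_L (generic K n p)].

Lemma tautological_slice : is_slice tautological_point.
Proof. by move=> r; rewrite slice_rels_rmorph => /mapP[s sg ->]; exact: to_loc_gens. Qed.

Lemma coef_tautological i j : coef tautological_point i j = to_L (coef (generic K n) i j).
Proof. exact: coef_rmorph. Qed.

Definition loc_cst (c : K) : L := to_L (c%:A : pol).

Fact loc_cst_zmod_morphism : zmod_morphism loc_cst.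
Proof. by move=> a b; rewrite /loc_cst scalerBl rmorphB. Qed.
Fact loc_cst_monoid_morphism : monoid_morphism loc_cst.
Proof.
by split=> [|a b]; rewrite /loc_cst ?scale1r ?rmorph1 // -rmorphM -scalerAl mul1r scalerA.
Qed.
HB.instance Definition _ := GRing.isZmodMorphism.Build K L loc_cst loc_cst_zmod_morphism.
HB.instance Definition _ := GRing.isMonoidMorphism.Build K L loc_cst loc_cst_monoid_morphism.

Lemma loc_cst_unit c : c != 0 -> loc_cst c * loc_cst c^-1 = 1.
Proof. by move=> c0; rewrite -rmorphM divff // rmorph1. Qed.

Section TrivialPoint.
Variable x : constants n K.
Hypothesis xS : is_slice x.
Hypothesis S_eval : forall f, f \in S -> eval_at x f != 0.
Hypothesis tautE : tautological_point = [ffun p => loc_cst (x p)].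

Lemma to_loc_eval f : to_L f = loc_cst (eval_at x f).
Proof.
apply: (@rmorph_mpoly_ext _ _ _ to_L (loc_cst \o meval (fun k => x (enum_val k)))) => [c|i] /=.
  by rewrite /loc_cst -[c%:A in RHS]mul_mpolyC mulr1 mevalC.
rewrite mevalXU; have := congr1 (fun z : constants n L => z (enum_val i)) tautE.
by rewrite !ffunE enum_valK.
Qed.

(** Evaluation at [x] of the chosen representative; the two cancellation lemmas below make it the
    inverse of [loc_cst]. *)
Definition loc_eval (z : L) : K := eval_at x (repr z).1 / eval_at x (val (repr z).2).

Lemma loc_cstK : cancel loc_cst loc_eval.
Proof.
move=> c; rewrite /loc_eval; case: (repr_frac gens c%:A (den1 S)).
change (Defs.frac gens c%:A (den1 S)) with (loc_cst c).
case: (repr _) => a [d dS] /= u uS [e E].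
pose ev : {rmorphism pol -> K} := meval (fun k => x (enum_val k)).
have evC : ev c%:A = c by rewrite /ev /= -mul_mpolyC mulr1 mevalC.
have := congr1 ev E; rewrite rmorph_sum big1 => [|i _]; last first.
  by rewrite rmorphM (eval_gens xS (mem_nth 0 (ltn_ord i)) : ev gens`_i = 0) mulr0.
rewrite rmorphM rmorphB !rmorphM rmorph1 mulr1 evC => /eqP.
rewrite mulf_eq0 (negPf (S_eval uS)) subr_eq0 /= => /eqP aE.
by rewrite [eval_at x a]aE mulfK // S_eval.
Qed.

Lemma loc_evalK : cancel loc_eval loc_cst.
Proof.
move=> z; rewrite /loc_eval.
have : Defs.frac gens (repr z).1 (repr z).2 = z.
  by rewrite /Defs.frac -surjective_pairing reprK.
case: (repr z) => a d /= zE; have := frac_to_loc gens a d.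
rewrite zE !to_loc_eval => E.
have -> : loc_cst (eval_at x a / eval_at x (val d)) =
  loc_cst (eval_at x a) * loc_cst (eval_at x (val d))^-1 by exact: rmorphM.
rewrite -E -mulrA loc_cst_unit ?mulr1 //.
by apply: S_eval; exact: valP.
Qed.

(** When the tautological point is constant, every polynomial has the same germ as its value at [x],
    so scalars exhaust the localization, which is then a copy of the field K. *)
Lemma trivial_localization : bijective (fun c : K => c *: (1 : L)) /\ reduced L.
Proof.
have scE c : c *: (1 : L) = loc_cst c by rewrite -to_loc_alg.
split; first by exists loc_eval => z; rewrite scE ?loc_cstK ?loc_evalK.
move=> z k; rewrite -[z]loc_evalK -rmorphXn -(rmorph0 loc_cst) => /(can_inj loc_cstK)/eqP.
by rewrite expf_eq0 => /andP[_ /eqP ->].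
Qed.

End TrivialPoint.

End SliceLocalization.
Arguments tautological_slice {K n} S _ _.

(** * Trivial local rings: n at most 6, and the Witt law *)

Section TrivialLocalRings.
Variables (K : fieldType) (n : nat) (n5 : (5 <= n)%N).
Notation pol := {mpoly K[#|{: pair_index n}|]}.
Notation gens := (slice_rels (generic K n)).

Lemma trivial_localization_small (S : mulrClosed pol) : (n <= 6)%N ->
    (forall f, f \in S -> eval_at (filiform K n) f != 0) ->
  bijective (fun c : K => c *: (1 : localization S gens)) /\ reduced (localization S gens).
Proof.
move=> n6 Sev; apply: (trivial_localization (filiform_slice n5) Sev).
apply: (slice_unique (tautological_slice S) (is_slice_rmorph (loc_cst S) (filiform_slice n5))).
  by rewrite !coef_out //; lia.
by move=> q d q4 qn; lia.
Qed.

Lemma trivial_local_ring_small : (n <= 6)%N -> trivial_local_ring (filiform K n).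
Proof. by move=> n6; case: (@trivial_localization_small (nonvanishing (filiform K n)) n6). Qed.

Lemma reduced_coordinate_ring_small : (n <= 6)%N -> reduced (coordinate_ring K n).
Proof.
move=> n6; case: (@trivial_localization_small (@only_one K n) n6) => // f /eqP ->.
by rewrite /eval_at meval1 oner_neq0.
Qed.

Hypothesis K_char0 : [pchar K] =i pred0.

Let natK m : (0 < m)%N -> (m%:R : K) != 0.
Proof. by move/(pcharf0P K).1: K_char0 => -> ; case: m. Qed.

Lemma eval_coef_generic (x : constants n K) i j : eval_at x (coef (generic K n) i j) = coef x i j.
Proof.
pose ev : {rmorphism pol -> K} := meval (fun k => x (enum_val k)).
rewrite -[LHS](coef_rmorph ev); congr (coef _ i j).
by apply/ffunP => p; rewrite ffunE; exact: eval_generic.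
Qed.

Section Localized.
Variable S : mulrClosed pol.
Notation L := (localization S gens).
Notation t := (coef (tautological_point S) 3 4).

Lemma loc_nat_unit m : (0 < m)%N -> exists e : L, m%:R * e = 1.
Proof.
move=> m0; exists (loc_cst S m%:R^-1).
by rewrite -(rmorph_nat (loc_cst S)) loc_cst_unit ?natK.
Qed.

Lemma loc_mulIf (a e b : L) : a * e = 1 -> a * b = 0 -> b = 0.
Proof. by move=> ae ab; rewrite -[b]mul1r -ae mulrAC ab mul0r. Qed.

End Localized.

Lemma trivial_local_ring_witt (w := normalized_witt K n) : (12 <= n)%N ->
  reduced (local_ring w) /\ trivial_local_ring w.
Proof.
move=> n12; have wS : is_slice w := normalized_witt_slice K_char0 n5.
have n7 : (7 <= n)%N by lia.
suff : tautological_point (nonvanishing w) =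
    [ffun p => loc_cst (nonvanishing w) (w p)].
  by move/(trivial_localization wS) => [].
have tS := tautological_slice (nonvanishing w).
apply: (slice_unique tS (is_slice_rmorph (loc_cst _) wS)) => [|q d q4 qn].
  rewrite coef_rmorph coef_normalized_witt34 //.
  have := slice_weight12 tS n12; set t := coef _ 3 4 => tE.
  (* The polynomial 36 X_34^5 does not vanish at w_n, so its germ is a unit and weight 12 leaves 10
     t = 1. *)
  have [e eE] : exists e, (36 * t ^+ 5) * e = 1.
    rewrite /t coef_tautological -(rmorph_nat (to_loc _ gens)) -rmorphXn -rmorphM.
    pose ev : {rmorphism pol -> K} := meval (fun k => w (enum_val k)).
    apply: to_loc_unit; change (ev (36 * coef (generic K n) 3 4 ^+ 5) != 0).
    rewrite rmorphM rmorphXn rmorph_nat [ev _]eval_coef_generic coef_normalized_witt34 //.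
    by rewrite mulf_neq0 ?expf_neq0 ?mulf_neq0 ?invr_neq0 ?oner_neq0 ?natK.
  have {}tE := loc_mulIf eE tE.
  have F : 10 * loc_cst (nonvanishing w) (1 / 10) = 1.
    by rewrite -(rmorph_nat (loc_cst _)) -rmorphM mul1r divff ?natK // rmorph1.
  have [e10 e10E] := loc_nat_unit (nonvanishing w) (isT : 0 < 10)%N.
  apply/eqP; rewrite -subr_eq0; apply/eqP; apply: (loc_mulIf e10E).
  by apply: (eq_of_lincomb2 1 (-1) tE F); ring.
rewrite !coef_rmorph -[1](rmorph1 (loc_cst _)) -!rmorphD mulrC.
by apply: loc_mulIf; apply: loc_cst_unit; exact: normalized_witt_reg.
Qed.

End TrivialLocalRings.

(** * The local ring at f_n *)

Lemma deformed_coef_rmorph (R R' : comPzRingType) (f : {rmorphism R -> R'}) u i j :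
  f (deformed_coef u i j) = deformed_coef (f u) i j.
Proof.
have E := (rmorph_nat, rmorph1, rmorph0, rmorphD, rmorphN, rmorphM, rmorphXn).
case: i => [|[|[|[|[|[|[|i]]]]]]]; try by rewrite /= !E.
- by case: j => [|[|[|[|[|[|[|[|j]]]]]]]]; rewrite /= !E.
- by case: j => [|[|[|[|[|[|[|[|j]]]]]]]]; rewrite /= !E.
- by case: j => [|[|[|[|[|[|[|j]]]]]]]; rewrite /= !E.
- by case: j => [|[|[|[|[|[|[|[|j]]]]]]]]; rewrite /= !E.
Qed.

Lemma in_qpolyE (K : fieldType) m (p : {poly K}) :
  in_qpoly 'X^(m.+1) p = p %% 'X^(m.+1) :> {poly K}.
Proof. by rewrite /= mk_monic_Xn Pdiv.IdomainMonic.modpE ?monicXn. Qed.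

Lemma in_qpoly_eq0 (K : fieldType) m (p : {poly K}) :
  (in_qpoly 'X^(m.+1) p == 0) = ('X^(m.+1) %| p).
Proof. by rewrite -val_eqE [val _]in_qpolyE. Qed.

Section FiliformLocalRing.
Variables (K : fieldType) (K_char0 : [pchar K] =i pred0) (n : nat) (n12 : (12 <= n)%N).
Notation pol := {mpoly K[#|{: pair_index n}|]}.
Notation gens := (slice_rels (generic K n)).
Notation S := (nonvanishing (filiform K n)).
Notation L := (localization S gens).
Notation to_L := (to_loc S gens).
Notation X34 := (coef (generic K n) 3 4).
Notation t := (coef (tautological_point S) 3 4).

Let natK m : (0 < m)%N -> (m%:R : K) != 0.
Proof. by move/(pcharf0P K).1: K_char0 => -> ; case: m. Qed.
Let n5 : (5 <= n)%N. Proof. exact: leq_trans n12. Qed.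
Let n7 : (7 <= n)%N. Proof. exact: leq_trans n12. Qed.

Lemma filiform_t5 : t ^+ 5 = 0.
Proof.
have E := slice_weight12 (tautological_slice S) n12.
have [e eE] := loc_nat_unit K_char0 S (isT : 0 < 36)%N.
(* At f_n the factor 10 X_34 - 1 takes the value -1, so it is the one that becomes a unit. *)
have dS : 10 * X34 - 1 \in S.
  pose ev : {rmorphism pol -> K} := meval (fun k => filiform K n (enum_val k)).
  change (ev (10 * X34 - 1) != 0); rewrite rmorphB rmorphM rmorph1 rmorph_nat.
  by rewrite [ev _]eval_coef_generic coef_filiform34 // mulr0 sub0r oppr_eq0 oner_neq0.
have [d dE] := to_loc_unit gens dS.
have {}dE : (10 * t - 1) * d = 1.
  by rewrite -[RHS]dE coef_tautological rmorphB rmorphM rmorph1 rmorph_nat.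
apply: (loc_mulIf eE).
by apply: (loc_mulIf dE); rewrite mulrC.
Qed.

Let half : 2 * loc_cst S 2^-1 = 1.
Proof. by rewrite -(rmorph_nat (loc_cst S)) loc_cst_unit ?natK. Qed.

Lemma tautological_deformed :
  tautological_point S = of_table n (deformed_coef (loc_cst S 2^-1 * t)).
Proof. exact: (slice_deformed n5 (tautological_slice S) half filiform_t5). Qed.

Notation halfX := (2^-1 *: 'X : {poly K}).

(** Substitution of the deformed table with t = X, that is u = X/2. Its values are kept in K[X],
    although the equations hold only modulo X^5, so that divisibility and coprimality arguments are
    available. *)
Definition poly_eval : {rmorphism pol -> {poly K}} :=
  mmap (@polyC K) (fun k => deformed_coef halfX (val (enum_val k)).1 (val (enum_val k)).2).

Lemma poly_eval_generic p :
  poly_eval (generic K n p) = of_table n (deformed_coef halfX) p.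
Proof. by rewrite !ffunE /poly_eval /= mmapX mmap1U enum_rankK. Qed.

Lemma poly_eval_X34 : poly_eval X34 = 'X.
Proof.
rewrite -(coef_rmorph poly_eval).
have -> : [ffun p => poly_eval (generic K n p)] = of_table n (deformed_coef halfX).
  by apply/ffunP => p; rewrite ffunE poly_eval_generic.
by rewrite coef_of_table //= mulr_natl -scaler_nat scalerA divff ?natK // scale1r.
Qed.

Lemma poly_evalC c : poly_eval c%:A = c%:P.
Proof. by rewrite /poly_eval /= -mul_mpolyC mulr1 mmapC. Qed.

Lemma poly_eval_gens r : r \in gens -> 'X^5 %| poly_eval r.
Proof.
pose pi : {rmorphism {poly K} -> {poly %/ ('X^5 : {poly K})}} := in_qpoly 'X^5.
move=> rg; rewrite -in_qpoly_eq0; apply/eqP.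
apply: (rmorph_gens (f := pi \o poly_eval) (z := of_table n (deformed_coef (pi halfX))) _ _ rg).
  apply: deformed_slice => //; rewrite -rmorphXn; apply/eqP.
  by rewrite [_ == 0]in_qpoly_eq0 exprZn dvdpZr ?dvdpp // expf_neq0 ?invr_neq0 ?natK.
by move=> p; rewrite /= poly_eval_generic !ffunE (deformed_coef_rmorph pi).
Qed.

(** The map X |-> t, which induces the isomorphism from K[X]/(X^5). *)
Definition germ_of_poly : {rmorphism {poly K} -> L} := to_L \o horner_alg X34.

Lemma germ_of_polyX : germ_of_poly 'X = t.
Proof. by rewrite /= horner_algX coef_tautological. Qed.

Lemma germ_of_polyZ c p : germ_of_poly (c *: p) = c *: germ_of_poly p.
Proof. by rewrite -mul_polyC rmorphM loc_scaleE; congr (_ * _); rewrite /= horner_algC. Qed.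

Lemma germ_of_poly_coefs m (p : {poly K}) : (size p <= m)%N ->
  germ_of_poly p = \sum_(k < m) p`_k *: t ^+ k.
Proof.
move=> pm; have {1}-> : p = \sum_(k < m) p`_k *: 'X^k.
  rewrite -poly_def; apply/polyP => k; rewrite coef_poly.
  by case: ltnP => // mk; rewrite nth_default // (leq_trans pm).
by rewrite rmorph_sum; apply: eq_bigr => k _; rewrite germ_of_polyZ rmorphXn germ_of_polyX.
Qed.

Lemma poly_eval_horner p : poly_eval (horner_alg X34 p) = p.
Proof.
rewrite /horner_alg /horner_morph -horner_map poly_eval_X34 -map_poly_comp.
rewrite (@eq_map_poly _ _ _ (@polyC K)) => [|c]; last exact: poly_evalC.
exact: comp_polyXr.
Qed.

(** Both sides are ring morphisms that agree on scalars, and on coordinates because the tautological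
    point is the deformed table. Hence every germ of a polynomial is a polynomial in t. *)
Lemma to_loc_poly_eval f : to_L f = germ_of_poly (poly_eval f).
Proof.
apply: (@rmorph_mpoly_ext _ _ _ to_L (germ_of_poly \o poly_eval)) => [c|i].
  by rewrite [RHS]/= poly_evalC horner_algC.
have := congr1 (fun z : constants n L => z (enum_val i)) tautological_deformed.
rewrite !ffunE enum_valK => E1; apply: (etrans E1) => {E1}.
have := poly_eval_generic (enum_val i); rewrite !ffunE enum_valK => E.
apply: etrans _ (esym (congr1 germ_of_poly E)); rewrite deformed_coef_rmorph.
congr deformed_coef; rewrite germ_of_polyZ germ_of_polyX loc_scaleE.
by [].
Qed.

Lemma poly_eval_at f : (poly_eval f).[0] = eval_at (filiform K n) f.
Proof.
apply: (@rmorph_mpoly_ext _ _ _ (horner_eval 0 \o poly_eval)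
          (meval (fun k => filiform K n (enum_val k)))) => [c|i] /=.
  by rewrite poly_evalC /horner_eval hornerC -mul_mpolyC mulr1 mevalC.
rewrite mevalXU filiformE //; have := poly_eval_generic (enum_val i).
rewrite !ffunE enum_valK => ->.
rewrite (deformed_coef_rmorph (horner_eval 0)); congr deformed_coef.
by rewrite [LHS]hornerZ hornerX mulr0.
Qed.

(** The constant term of [poly_eval f] is the value of [f] at f_n, which is nonzero for a
    denominator. *)
Lemma poly_eval_coprime f : f \in S -> coprimep 'X^5 (poly_eval f).
Proof.
move=> fS; apply: coprimep_expl; rewrite coprimep_sym.
by have := coprimep_XsubC (poly_eval f) 0; rewrite subr0 rootE poly_eval_at => ->.
Qed.

(** One direction is t^5 = 0. Conversely, a vanishing germ is killed by some denominator [u];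
    applying [poly_eval] gives that X^5 divides [poly_eval u * p], and the factor coprime to X^5 is
    removed by Gauss. *)
Lemma germ_of_poly_eq0 p : (germ_of_poly p == 0) = ('X^5 %| p).
Proof.
apply/eqP/idP => [p0|/dvdpP[q ->]]; last first.
  by rewrite rmorphM rmorphXn germ_of_polyX filiform_t5 mulr0.
pose pi : {rmorphism {poly K} -> {poly %/ ('X^5 : {poly K})}} := in_qpoly 'X^5.
have [|u uS] := to_loc_eq0 (f := pi \o poly_eval) _ p0.
  by move=> r rg; apply/eqP; rewrite [_ == 0]in_qpoly_eq0 poly_eval_gens.
rewrite -rmorphM [LHS]/= rmorphM poly_eval_horner => /eqP.
by rewrite in_qpoly_eq0 Gauss_dvdpr // poly_eval_coprime.
Qed.

Lemma germ_of_poly_surj z : exists p, germ_of_poly p = z.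
Proof.
case: (fracP z) => -[a d] ->; have := frac_to_loc gens a d.
rewrite !to_loc_poly_eval => E.
(* The Bezout coefficient [r] inverts the denominator modulo X^5, so the fraction is itself the germ
   of a polynomial in t. *)
have /Bezout_eq1_coprimepP[[q r] /= qr] := poly_eval_coprime (valP d).
have gM p p' : germ_of_poly (p * p') = germ_of_poly p * germ_of_poly p' by exact: rmorphM.
exists (r * poly_eval a); apply: (etrans (gM _ _)); rewrite -E mulrCA.
rewrite -[X in _ * X](gM r (poly_eval (val d))).
have -> : r * poly_eval (val d) = 1 - q * 'X^5.
  by apply: (eq_of_lincomb 1 (qr : q * 'X^5 + r * poly_eval (val d) = 1)); ring.
have /eqP q0 : germ_of_poly (q * 'X^5) == 0 by rewrite germ_of_poly_eq0 dvdp_mulIr.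
have -> : germ_of_poly (1 - q * 'X^5) = germ_of_poly 1 - germ_of_poly (q * 'X^5).
  exact: rmorphB.
have -> : germ_of_poly 1 = 1 by exact: rmorph1.
by rewrite q0 subr0 mulr1.
Qed.

Lemma germ_of_polyXn k : germ_of_poly 'X^k = t ^+ k.
Proof. by rewrite -germ_of_polyX; exact: rmorphXn. Qed.

Lemma filiform_t4 : t ^+ 4 <> 0.
Proof. by rewrite -germ_of_polyXn => /eqP; rewrite germ_of_poly_eq0 dvdp_Pexp2l ?size_polyX. Qed.

Lemma local_ring_basis (a : L) : exists! c : {ffun 'I_5 -> K}, a = \sum_k c k *: t ^+ k.
Proof.
have [p pa] := germ_of_poly_surj a.
pose poly_of (c : {ffun 'I_5 -> K}) := \poly_(k < 5) c (inord k).
have germ_of c : germ_of_poly (poly_of c) = \sum_k c k *: t ^+ k.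
  rewrite (germ_of_poly_coefs (size_poly _ _)); apply: eq_bigr => k _.
  by rewrite coef_poly ltn_ord inord_val.
exists [ffun k : 'I_5 => (p %% 'X^5)`_k]; split=> [|c ac].
  transitivity (germ_of_poly (p %% 'X^5)).
    rewrite -pa; apply/eqP; rewrite -subr_eq0.
    have -> : germ_of_poly p - germ_of_poly (p %% 'X^5) = germ_of_poly (p - p %% 'X^5).
      by apply/esym; exact: rmorphB.
    by rewrite germ_of_poly_eq0 {1}(divp_eq p 'X^5) addrK dvdp_mulIr.
  rewrite (@germ_of_poly_coefs 5); first by apply: eq_bigr => k _; rewrite ffunE.
  by have := ltn_modp p 'X^5; rewrite size_polyXn -size_poly_gt0 size_polyXn.
have E : p %% 'X^5 = poly_of c.
  rewrite -[RHS](@modp_small _ _ 'X^5); last by rewrite size_polyXn ltnS size_poly.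
  apply/eqP; rewrite -subr_eq0 -modpN -modpD -[_ == 0]/('X^5 %| _) -germ_of_poly_eq0.
  have -> : germ_of_poly (p - poly_of c) = germ_of_poly p - germ_of_poly (poly_of c).
    exact: rmorphB.
  by rewrite germ_of pa ac subrr.
by apply/ffunP => k; rewrite ffunE E coef_poly ltn_ord inord_val.
Qed.

Definition germ_of_qpoly (q : {poly %/ ('X^5 : {poly K})}) : L := germ_of_poly (val q).

Lemma germ_of_in_qpoly p : germ_of_qpoly (in_qpoly 'X^5 p) = germ_of_poly p.
Proof.
rewrite /germ_of_qpoly [val _]in_qpolyE; apply/eqP; rewrite -subr_eq0.
have -> : germ_of_poly (p %% 'X^5) - germ_of_poly p = germ_of_poly (p %% 'X^5 - p).
  by apply/esym; exact: rmorphB.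
by rewrite germ_of_poly_eq0 {2}(divp_eq p 'X^5) opprD addrCA subrr addr0 dvdpNr dvdp_mulIr.
Qed.

Fact germ_of_qpoly_zmod_morphism : zmod_morphism germ_of_qpoly.
Proof. by move=> p q; exact: (rmorphB germ_of_poly). Qed.

Fact germ_of_qpoly_monoid_morphism : monoid_morphism germ_of_qpoly.
Proof.
split=> [|p q]; first exact: (rmorph1 germ_of_poly).
change (p * q) with (in_qpoly 'X^5 (val p * val q)).
by rewrite germ_of_in_qpoly; exact: (rmorphM germ_of_poly).
Qed.

HB.instance Definition _ := GRing.isZmodMorphism.Build {poly %/ ('X^5 : {poly K})} L
  germ_of_qpoly germ_of_qpoly_zmod_morphism.
HB.instance Definition _ := GRing.isMonoidMorphism.Build {poly %/ ('X^5 : {poly K})} L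
  germ_of_qpoly germ_of_qpoly_monoid_morphism.

Lemma germ_of_qpolyZ c q : germ_of_qpoly (c *: q) = c *: germ_of_qpoly q.
Proof. exact: germ_of_polyZ. Qed.

Lemma germ_of_qpolyX : germ_of_qpoly 'qX = t.
Proof. by rewrite /qpolyX germ_of_in_qpoly germ_of_polyX. Qed.

Lemma germ_of_qpoly_bij : bijective germ_of_qpoly.
Proof.
have surj z : exists q, germ_of_qpoly q = z.
  by have [p <-] := germ_of_poly_surj z; exists (in_qpoly 'X^5 p); exact: germ_of_in_qpoly.
have [g gK] := choice surj; exists g => // q.
apply/eqP; rewrite -subr_eq0; set d := _ - q.
have : germ_of_qpoly d = 0.
  have -> : germ_of_qpoly d = germ_of_qpoly (g (germ_of_qpoly q)) - germ_of_qpoly q.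
    exact: (rmorphB germ_of_qpoly).
  by rewrite gK subrr.
move/eqP; rewrite germ_of_poly_eq0 -in_qpoly_eq0.
by rewrite (_ : in_qpoly _ _ = d) //; apply/val_inj/in_qpoly_small/size_mk_monic.
Qed.

Lemma local_ring_qpoly : exists phi : {rmorphism {poly %/ ('X^5 : {poly K})} -> L},
  [/\ bijective phi, forall (c : K) q, phi (c *: q) = c *: phi q & phi 'qX = t].
Proof.
exists germ_of_qpoly.
by split; [exact: germ_of_qpoly_bij|exact: germ_of_qpolyZ|exact: germ_of_qpolyX].
Qed.

Lemma not_reduced_local_ring : ~ reduced L.
Proof. by move=> /(_ _ _ filiform_t5) t0; case: filiform_t4; rewrite t0 expr0n. Qed.


End FiliformLocalRing.

(** * The canonical deformation in the stated form *)

Section FiliformDeformation.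
Variables (K : fieldType) (K_char0 : [pchar K] =i pred0) (n : nat).
Notation A := (local_ring (filiform K n)).

(** A copy of [loc_cst] typed with [local_ring], so that it carries its morphism structure at that
    type. *)
Definition germ_cst (c : K) : A := loc_cst (nonvanishing (filiform K n)) c.

Fact germ_cst_zmod_morphism : zmod_morphism germ_cst.
Proof. exact: loc_cst_zmod_morphism. Qed.
Fact germ_cst_monoid_morphism : monoid_morphism germ_cst.
Proof. exact: loc_cst_monoid_morphism. Qed.
HB.instance Definition _ := GRing.isZmodMorphism.Build K A germ_cst germ_cst_zmod_morphism.
HB.instance Definition _ := GRing.isMonoidMorphism.Build K A germ_cst germ_cst_monoid_morphism.

Lemma germ_scaleE c (z : A) : c *: z = germ_cst c * z.
Proof. exact: loc_scaleE. Qed.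

Let h2 : (2 : K) != 0. Proof. by rewrite ((pcharf0P K).1 K_char0). Qed.

(** Translates between the polynomials in m = i + j and t with denominators 2, 4, 8, 16 and the
    integral table in u = t/2 and a shifted index. *)
Lemma filiform_deformationE (t : A) i j : (0 < i < j)%N ->
  filiform_deformation t i j = deformed_coef (germ_cst 2^-1 * t) i j.
Proof.
move=> ij; set u := germ_cst 2^-1 * t; set e := germ_cst 2^-1 in u *.
have eE : e * 2 = 1 by rewrite -(rmorph_nat germ_cst) -rmorphM mulVf ?rmorph1.
have tE : t = 2 * u by rewrite /u mulrA [2 * e]mulrC eE mul1r.
rewrite /e in eE; clearbody u; rewrite {e}tE.
have d4 : (4 : K)^-1 = 2^-1 ^+ 2 by rewrite exprVn -natrX.
have d8 : (8 : K)^-1 = 2^-1 ^+ 3 by rewrite exprVn -natrX.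
have d16 : (16 : K)^-1 = 2^-1 ^+ 4 by rewrite exprVn -natrX.
(* Naming 2 as [w] turns [eE] into [e * w = 1] for the inverse [e] of 2, an equation between atoms
   by which [ring: eE wE] can reduce. *)
have [w wE] : {w : A | w = 2} by exists 2.
rewrite -[in (2 * u)]wE -wE in eE *.
case: i ij => [|[|[|[|[|[|[|i]]]]]]] // ij.
- case: j ij => [|[|[|[|[|[|[|j]]]]]]] // _;
    rewrite /filiform_deformation ?germ_scaleE /deformed_coef ?(d4, d8, d16); ring: eE wE.
- case: j ij => [|[|[|[|[|[|[|[|j]]]]]]]] // _;
    rewrite /filiform_deformation ?germ_scaleE /deformed_coef ?(d4, d8, d16); ring: eE wE.
- case: j ij => [|[|[|[|[|[|[|j]]]]]]] // _;
    rewrite /filiform_deformation ?germ_scaleE /deformed_coef ?(d4, d8, d16); ring: eE wE.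
- case: j ij => [|[|[|[|[|[|[|[|j]]]]]]]] // _;
    rewrite /filiform_deformation ?germ_scaleE /deformed_coef ?(d4, d8, d16); ring: eE wE.
- by rewrite /filiform_deformation germ_scaleE /deformed_coef; ring: eE wE.
Qed.

Lemma canonical_filiform_deformation (t := coef (canonical_deformation (filiform K n)) 3 4) :
  (12 <= n)%N ->
  canonical_deformation (filiform K n) = of_table n (filiform_deformation t).
Proof.
move=> n12; have -> : canonical_deformation (filiform K n) =
    of_table n (deformed_coef (germ_cst 2^-1 * t)).
  exact: tautological_deformed.
apply: constants_ext => i j ij ijn.
by rewrite !(coef_of_table _ ij ijn) filiform_deformationE.
Qed.

End FiliformDeformation.

Theorem theorem6p3 (K : closedFieldType) (K_char0 : [pchar K] =i pred0)
    (n : nat) (n_ge5 : (5 <= n)%N) :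
  [/\
    (n <= 6)%N ->
      exists x : constants n K,
        [/\ forall y : constants n K, is_slice y <-> y = x,
            rigid x,
            reduced (coordinate_ring K n)
          & trivial_local_ring x],

    (7 <= n <= 11)%N ->
      (forall y : constants n K, is_slice y <->
         exists t : K,
           [/\ (9 <= n)%N -> t <> - 2,
               (11 <= n)%N -> t <> 1 /\ t <> - 1
             & y = family_law n t]) /\
      (forall (R : comUnitAlgType K) (y : constants n R), is_slice y <->
         exists t : R,
           [/\ (9 <= n)%N -> t + 2 \is a GRing.unit,
               (11 <= n)%N -> (t - 1 \is a GRing.unit) /\ (t + 1 \is a GRing.unit)
             & y = family_law n t])

  & (12 <= n)%N ->
      exists w : constants n K,
        [/\ is_witt_law w /\ (forall y, is_witt_law y -> y = w),
            forall y : constants n K, is_slice y <-> y = filiform K n \/ y = w,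
            coef (filiform K n) 3 4 = 0 /\ coef w 3 4 = 1 / 10,
            rigid (filiform K n) /\ rigid w
          & [/\ reduced (local_ring w) /\ trivial_local_ring w,
                ~ reduced (local_ring (filiform K n))
              & let t := coef (canonical_deformation (filiform K n)) 3 4 in
                [/\ t ^+ 5 = 0 /\ t ^+ 4 <> 0,
                    forall a : local_ring (filiform K n),
                      exists! c : {ffun 'I_5 -> K}, a = \sum_k c k *: t ^+ k,
                    exists phi : {rmorphism {poly %/ ('X^5 : {poly K})} ->
                                             local_ring (filiform K n)},
                      [/\ bijective phi,
                          forall (c : K) a, phi (c *: a) = c *: phi a
                        & phi 'qX = t]
                  & canonical_deformation (filiform K n) =
                      of_table n (filiform_deformation t)]]]].
Proof.
split.
- move=> n6; exists (filiform K n); split.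
  + by move=> y; exact: small_slice_unique.
  + exact: rigid_filiform_small.
  + exact: reduced_coordinate_ring_small.
  + exact: trivial_local_ring_small.
- move=> n7_11; split=> [y|R y].
    have natU m : (0 < m)%N -> (m%:R : K) \is a GRing.unit.
      by move=> m0; rewrite unitfE ((pcharf0P K).1 K_char0) -lt0n.
    rewrite (slice_familyP natU y n7_11); split=> -[t [t9 t11 ->]]; exists t; split=> //.
    * by move=> /t9; rewrite unitfE addr_eq0 => /eqP.
    * by move=> /t11; rewrite !unitfE subr_eq0 addr_eq0 => -[/eqP ? /eqP ?].
    * by move=> /t9/eqP; rewrite unitfE addr_eq0.
    * by move=> /t11[/eqP ? /eqP ?]; rewrite !unitfE subr_eq0 addr_eq0.
  apply: slice_familyP n7_11 => m m0.
  rewrite -(rmorph_nat (in_alg R)) rmorph_unit // unitfE ((pcharf0P K).1 K_char0).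
  by rewrite -lt0n.
- move=> n12; exists (normalized_witt K n); split.
  + exact: witt_lawP.
  + by move=> y; exact: slice_fieldP.
  + by split; [exact: coef_filiform34|apply: coef_normalized_witt34 => //; lia].
  + by split; [exact: rigid_filiform|exact: rigid_normalized_witt].
  + split; first exact: trivial_local_ring_witt.
      exact: (not_reduced_local_ring K_char0 n12).
    split.
    * by split; [exact: (filiform_t5 K_char0 n12)|exact: (filiform_t4 K_char0 n12)].
    * exact: (local_ring_basis K_char0 n12).
    * exact: (local_ring_qpoly K_char0 n12).
    * exact: (canonical_filiform_deformation K_char0 n12).
Qed.
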